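(* Assume (A) and ($\mathrm{A}_+$) (as stated in the context), and let $\ell\in C^1(X)$ be Lipschitz on bounded subsets of $X$. Let $\alpha\ge 0$, $\mathrm x_0\in X$ and let $\bar u,u\in\mathcal U$ be arbitrary. Put $x_t\doteq\Phi^u_{0,t}(\mathrm x_0)$ and $\bar p_t\doteq \ell\circ\Phi^{\bar u}_{t,T}$ for $t\in I$, and $$\bar H_t(\mathrm x,\mathrm u)\doteq\frac{\alpha}{2}|\mathrm u|^2+\mathrm u^T G_t(\mathrm x)'D\bar p_t(\mathrm x),\qquad (t,\mathrm x,\mathrm u)\in I\times X\times\mathbb R^m .$$ Then $$\mathcal I[u]-\mathcal I[\bar u]=\int_I\Bigl(\bar H_t(x_t,u(t))-\bar H_t(x_t,\bar u(t))\Bigr)\,\mathrm dt .$$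
   Context: Setting. $X$ is a real Banach space, $T>0$, $I=[0,T]$, $U\subset\mathbb R^m$ is compact and convex, and $\mathcal U=L^\infty(I;U)$ is the set of (classes of) measurable functions $I\to\mathbb R^m$ with values in $U$ a.e., viewed as a subset of $L^\infty(I;\mathbb R^m)$. The linear operator $A\colon D(A)\subset X\to X$ generates a $C_0$-semigroup $(S_t)_{t\ge0}$ on $X$. Maps $f\colon I\times X\to X$ and $G\colon I\times X\to\mathcal L(\mathbb R^m;X)$ are given, and $F_t(\mathrm x,\mathrm u)=f_t(\mathrm x)+G_t(\mathrm x)\mathrm u$. Measurability of Banach-space-valued maps on $I$ is in the strong (Bochner) sense. Assumption (A): for every $\mathrm x\in X$ the maps $t\mapsto f_t(\mathrm x)$ and $t\mapsto G_t(\mathrm x)$ are measurable, and there exist constants $M_f,M_G\ge0$ such that for all $\mathrm x,\mathrm y\in X$ and a.a. $t\in I$: $\|f_t(\mathrm x)-f_t(\mathrm y)\|_X\le M_f\|\mathrm x-\mathrm y\|_X$, $\|G_t(\mathrm x)-G_t(\mathrm y)\|_{\mathcal L(\mathbb R^m;X)}\le M_G\|\mathrm x-\mathrm y\|_X$, $\|f_t(0)\|_X\le M_f$, $\|G_t(0)\|_{\mathcal L(\mathbb R^m;X)}\le M_G$. Assumption ($\mathrm{A}_+$): for a.a. $t\in I$ the maps $f_t\colon X\to X$ and $G_t\colon X\to\mathcal L(\mathbb R^m;X)$ are $C^1$ (continuously Fréchet differentiable); for every $\mathrm x\in X$ the maps $t\mapsto Df_t(\mathrm x)$ and $t\mapsto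 DG_t(\mathrm x)$ are strongly measurable; and, for a.a. $t\in I$, the maps $\mathrm x\mapsto Df_t(\mathrm x)$ and $\mathrm x\mapsto DG_t(\mathrm x)$ are globally bounded and Lipschitz on $X$ (in operator norm) with a common constant $M\ge0$. Flow. For $u\in\mathcal U$, $s\in[0,T)$, $\mathrm x\in X$, $t\mapsto\Phi^u_{s,t}(\mathrm x)\in C([s,T];X)$ denotes the unique mild solution of $\dot x_t=Ax_t+F_t(x_t,u(t))$, $x_s=\mathrm x$, i.e. $\Phi^u_{s,t}(\mathrm x)=S_{t-s}\mathrm x+\int_s^tS_{t-\tau}F_\tau(\Phi^u_{s,\tau}(\mathrm x),u(\tau))\,\mathrm d\tau$ for $t\in[s,T]$ (existence and uniqueness hold under (A)); also $\Phi^u_{T,T}=\mathrm{id}_X$. Cost. $\mathcal I[u]=\ell(\Phi^u_{0,T}(\mathrm x_0))+\frac{\alpha}{2}\int_I|u(t)|^2\,\mathrm dt$. Under the hypotheses, each $\bar p_t\colon X\to\mathbb R$ is Fréchet differentiable, with derivative $D\bar p_t(\mathrm x)\in X'$. $L'$ denotes the adjoint of a bounded operator $L$, so $G_t(\mathrm x)'D\bar p_t(\mathrm x)\in\mathbb R^m$ is the vector with $v^T G_t(\mathrm x)'D\bar p_t(\mathrm x)=D\bar p_t(\mathrm x)[G_t(\mathrm x)v]$ for all $v\in\mathbb R^m$. *)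

(* Defs.v *)
From HB Require Import structures.
From mathcomp Require Import all_boot all_order all_algebra.
From mathcomp Require Import all_classical all_reals all_analysis.

Set Implicit Arguments.
Unset Strict Implicit.
Unset Printing Implicit Defensive.
Import Order.TTheory GRing.Theory Num.Theory.
Import numFieldNormedType.Exports.

Local Open Scope classical_set_scope.
Local Open Scope ring_scope.

(* [bounded_op V W] is made a [normedModType] for the operator norm, so that
   limits, derivatives and strong measurability of operator-valued maps are all
   taken with respect to that norm. *)
Section BoundedOperators.
Context {R : realType} {V W : normedModType R}.

Definition is_bounded_op : {pred V -> W} :=
  fun f => `[< linear f /\ continuous f >].

Record bounded_op := BoundedOp {
  bounded_op_fun :> V -> W ;
  bounded_opP : bounded_op_fun \in is_bounded_op }.

HB.instance Definition _ := [isSub for bounded_op_fun].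
HB.instance Definition _ := [Choice of bounded_op by <:].

Lemma bounded_op_submod_closed : submod_closed is_bounded_op.
Proof.
split.
  by apply/asboolP; split=> [a x y|];
    [rewrite /= scaler0 addr0 | exact: cst_continuous].
move=> a f g /asboolP[lf cf] /asboolP[lg cg]; apply/asboolP; split.
  move=> b x y; rewrite -![(_ + _) _]/(_ + _) -![(_ *: _) _]/(_ *: _).
  by rewrite lf lg !scalerDr !scalerA (mulrC b) addrACA.
move=> x; apply: cvgD; last exact: cg.
by apply: cvgZr; exact: cf.
Qed.

HB.instance Definition _ :=
  GRing.isSubmodClosed.Build R (V -> W) is_bounded_op bounded_op_submod_closed.
HB.instance Definition _ := [SubChoice_isSubLmodule of bounded_op by <:].

Lemma bounded_op_linear (f : bounded_op) : linear f.
Proof. by case: f => f /= /asboolP[]. Qed.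

HB.instance Definition _ (f : bounded_op) :=
  GRing.isLinear.Build R V W *:%R f (bounded_op_linear f).

Lemma bounded_op_continuous (f : bounded_op) : continuous f.
Proof. by case: f => f /= /asboolP[]. Qed.

Definition opnorm (f : bounded_op) : R :=
  sup [set `|f x| | x in [set x : V | `|x| <= 1]].

Lemma has_sup_opnorm (f : bounded_op) :
  has_sup [set `|f x| | x in [set x : V | `|x| <= 1]].
Proof.
split; first by exists `|f 0|; exists 0; rewrite /= ?normr0.
have /linear_bounded_continuous/linear_boundedP/pinfty_ex_gt0[r r0 fr] :=
  @bounded_op_continuous f.
exists r => _ [x /= x1 <-]; apply: le_trans (fr x) _.
by rewrite ler_piMr// ltW.
Qed.

Lemma opnorm_ub (f : bounded_op) x : `|x| <= 1 -> `|f x| <= opnorm f.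
Proof.
by move=> x1; apply: sup_upper_bound (has_sup_opnorm f) _ _; exists x.
Qed.

Lemma opnorm_le (f : bounded_op) M :
  (forall x, `|x| <= 1 -> `|f x| <= M) -> opnorm f <= M.
Proof.
move=> fM; apply: ge_sup; first by case: (has_sup_opnorm f).
by move=> _ [x /= x1 <-]; exact: fM.
Qed.

Lemma opnorm_bound (f : bounded_op) x : `|f x| <= opnorm f * `|x|.
Proof.
have [->|x0] := eqVneq x 0; first by rewrite raddf0 !normr0 mulr0.
have nx0 : 0 < `|x| by rewrite normr_gt0.
have : `|f (`|x|^-1 *: x)| <= opnorm f.
  by apply: opnorm_ub; rewrite normrZ gtr0_norm ?invr_gt0// mulVf ?gt_eqF.
by rewrite linearZ/= normrZ gtr0_norm ?invr_gt0// mulrC ler_pdivrMr.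
Qed.

Lemma ler_opnormD (f g : bounded_op) : opnorm (f + g) <= opnorm f + opnorm g.
Proof.
apply: opnorm_le => x x1; rewrite -[_ x]/(f x + g x).
by rewrite (le_trans (ler_normD _ _))// lerD// opnorm_ub.
Qed.

Lemma opnorm_ge0 (f : bounded_op) : 0 <= opnorm f.
Proof.
by have := @opnorm_ub f 0; rewrite normr0 ler01 => /(_ isT); exact: le_trans.
Qed.

Lemma opnormZ_le (a : R) (f : bounded_op) : opnorm (a *: f) <= `|a| * opnorm f.
Proof.
apply: opnorm_le => x x1; rewrite -[_ x]/(a *: f x) normrZ.
by rewrite ler_wpM2l// opnorm_ub.
Qed.

Lemma opnormZ (a : R) (f : bounded_op) : opnorm (a *: f) = `|a| * opnorm f.
Proof.
apply/eqP; rewrite eq_le opnormZ_le/=.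
have [->|a0] := eqVneq a 0; first by rewrite normr0 mul0r opnorm_ge0.
rewrite -ler_pdivlMl ?normr_gt0// -normfV.
by rewrite -{1}[f]scale1r -(mulVf a0) -scalerA opnormZ_le.
Qed.

Lemma opnorm0_eq0 (f : bounded_op) : opnorm f = 0 -> f = 0.
Proof.
move=> f0; apply: val_inj; apply/funext => x; apply/eqP.
by rewrite -normr_le0 (le_trans (opnorm_bound f x))// f0 mul0r.
Qed.

HB.instance Definition _ :=
  Lmodule_isNormed.Build R bounded_op ler_opnormD opnormZ opnorm0_eq0.

End BoundedOperators.
Arguments bounded_op {R} V W.

Section Frechet.
Context {R : realType} {V W : normedModType R}.

(* The library's ['d f x] is only a linear map; its continuity is part of
   [differentiable f x]. *)
Definition fderiv (f : V -> W) (x : V) : bounded_op V W :=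
  insubd 0 ('d f x : V -> W).

Lemma fderivE (f : V -> W) (x : V) :
  differentiable f x -> fderiv f x = 'd f x :> (V -> W).
Proof.
move=> dfx; rewrite /fderiv -[LHS]/(val _) insubdK//; apply/asboolP; split.
  exact: linearP.
exact: diff_continuous.
Qed.

Definition C1 (f : V -> W) : Prop :=
  (forall x, differentiable f x) /\ continuous (fderiv f).

End Frechet.

Section Bochner.
Context {d : measure_display} {Omega : measurableType d} {R : realType}.
Context {Y : normedModType R}.
Variable mu : {measure set Omega -> \bar R}.

(* The finiteness clause makes [fine] harmless in [simple_integral]: the only
   level set of possibly infinite measure is that of 0. *)
Definition bochner_simple (D : set Omega) (s : Omega -> Y) : Prop :=
  [/\ finite_set (range s),
      forall y, measurable (D `&` s @^-1` [set y]) &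
      forall y, y != 0 -> (mu (D `&` s @^-1` [set y]) < +oo)%E].

Definition simple_integral (D : set Omega) (s : Omega -> Y) : Y :=
  \sum_(y \in range s) fine (mu (D `&` s @^-1` [set y])) *: y.

Definition ae_limit (D : set Omega) (s_ : nat -> Omega -> Y) (f : Omega -> Y) :=
  {ae mu, forall w, D w -> s_ n w @[n --> \oo] --> f w}.

Definition strongly_measurable (D : set Omega) (f : Omega -> Y) : Prop :=
  exists2 s_ : nat -> Omega -> Y,
    forall n, bochner_simple D (s_ n) & ae_limit D s_ f.

(* [f] need not be Borel measurable: [ae_limit] makes the norm
   in the third clause a.e. equal to a Borel function, which the library's
   integral, a supremum over simple functions, does not distinguish from it. *)
Definition is_bochner_integral (D : set Omega) (f : Omega -> Y) (v : Y) : Prop :=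
  exists s_ : nat -> Omega -> Y,
    [/\ forall n, bochner_simple D (s_ n),
        ae_limit D s_ f,
        (\int[mu]_(w in D) `|f w - s_ n w|%:E)%E @[n --> \oo] --> 0%E &
        simple_integral D (s_ n) @[n --> \oo] --> v].

Definition bochner_integrable (D : set Omega) (f : Omega -> Y) : Prop :=
  exists v, is_bochner_integral D f v.

Definition bochner_integral (D : set Omega) (f : Omega -> Y) : Y :=
  get (is_bochner_integral D f).

End Bochner.

Section Semigroup.
Context {R : realType} {X : normedModType R}.

(* Only the values of [S] at nonnegative times matter. *)
Definition C0_semigroup (S : R -> bounded_op X X) : Prop :=
  [/\ forall x, S 0 x = x,
      forall s t x, 0 <= s -> 0 <= t -> S (s + t) x = S s (S t x) &
      forall x, S t x @[t --> 0^'+] --> x].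

(* The operator A with domain [DA] is the total function [A] restricted to
   [DA]. *)
Definition generates (DA : set X) (A : X -> X) (S : R -> bounded_op X X) : Prop :=
  [/\ C0_semigroup S,
      forall x, DA x <-> cvg (h^-1 *: (S h x - x) @[h --> 0^'+]) &
      forall x, DA x -> h^-1 *: (S h x - x) @[h --> 0^'+] --> A x].

End Semigroup.

Section ControlSystem.
Context {R : realType} {X : completeNormedModType R} {m : nat}.
Local Notation Rm := 'cV[R]_m.
Local Notation leb := (@lebesgue_measure R).

(* Elements of L^oo([0, T]; U) are given by representatives; as U is compact,
   essential boundedness is automatic. Since [leb] is defined on Borel sets,
   Lebesgue measurability is rendered by [strongly_measurable]. *)
Definition admissible (T : R) (U : set Rm) (u : R -> Rm) : Prop :=
  strongly_measurable leb `[0, T] u /\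
  {ae leb, forall t, t \in `[0, T] -> U (u t)}.

(* The library's norm on column vectors is the max norm; being equivalent to
   the Euclidean one, it leaves the two assumptions below unchanged up to the
   values of the constants. *)
Definition assumption_A (T : R) (f : R -> X -> X)
    (G : R -> X -> bounded_op Rm X) : Prop :=
  (forall x, strongly_measurable leb `[0, T] (f ^~ x) /\
             strongly_measurable leb `[0, T] (G ^~ x)) /\
  exists Mf MG : R, [/\ 0 <= Mf, 0 <= MG &
    {ae leb, forall t, t \in `[0, T] ->
      [/\ forall x y, `|f t x - f t y| <= Mf * `|x - y|,
          forall x y, `|G t x - G t y| <= MG * `|x - y|,
          `|f t 0| <= Mf &
          `|G t 0| <= MG]}].

Definition assumption_Aplus (T : R) (f : R -> X -> X)
    (G : R -> X -> bounded_op Rm X) : Prop :=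
  [/\ {ae leb, forall t, t \in `[0, T] -> C1 (f t) /\ C1 (G t)},
      forall x, strongly_measurable leb `[0, T] (fun t => fderiv (f t) x) /\
                strongly_measurable leb `[0, T] (fun t => fderiv (G t) x) &
      exists2 M : R, 0 <= M &
        {ae leb, forall t, t \in `[0, T] ->
          [/\ forall x, `|fderiv (f t) x| <= M,
              forall x, `|fderiv (G t) x| <= M,
              forall x y, `|fderiv (f t) x - fderiv (f t) y| <= M * `|x - y| &
              forall x y, `|fderiv (G t) x - fderiv (G t) y| <= M * `|x - y|]}].

Definition dynamics (f : R -> X -> X) (G : R -> X -> bounded_op Rm X)
    (t : R) (x : X) (v : Rm) : X := f t x + G t x v.

Definition mild_solution (S : R -> bounded_op X X) (F : R -> X -> Rm -> X)
    (T : R) (u : R -> Rm) (s : R) (x : X) (y : R -> X) : Prop :=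
  {within `[s, T], continuous y} /\
  forall t, s <= t <= T ->
    let g := fun tau => S (t - tau) (F tau (y tau) (u tau)) in
    bochner_integrable leb `[s, t] g /\
    y t = S (t - s) x + bochner_integral leb `[s, t] g.

Definition is_flow (S : R -> bounded_op X X) (F : R -> X -> Rm -> X)
    (T : R) (U : set Rm) (Phi : (R -> Rm) -> R -> R -> X -> X) : Prop :=
  forall u, admissible T U u ->
    (forall s x, 0 <= s < T ->
       mild_solution S F T u s x (fun t => Phi u s t x)) /\
    (forall x, Phi u T T x = x).

Definition sqnorm (v : Rm) : R := \sum_(i < m) v i ord0 ^+ 2.

Definition cost (T alpha : R) (l : X -> R)
    (Phi : (R -> Rm) -> R -> R -> X -> X) (x0 : X) (u : R -> Rm) : R :=
  l (Phi u 0 T x0) + alpha / 2 * \int[leb]_(t in `[0, T]) sqnorm (u t).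

(* The vector L' p of R^m, for L in L(R^m; X) and p in X'. *)
Definition adjoint (L : bounded_op Rm X) (p : bounded_op X R) : Rm :=
  \col_i p (L (delta_mx i ord0)).

Lemma adjointE (L : bounded_op Rm X) (p : bounded_op X R) (v : Rm) :
  (v^T *m adjoint L p) ord0 ord0 = p (L v).
Proof.
have {2}-> : v = \sum_i v i ord0 *: delta_mx i ord0.
  rewrite [LHS]matrix_sum_delta; apply: eq_bigr => i _.
  by rewrite big_ord1 [X in v i X]ord1.
rewrite !linear_sum mxE; apply: eq_bigr => i _.
by rewrite !mxE !linearZ.
Qed.

Definition terminal_value (T : R) (l : X -> R)
    (Phi : (R -> Rm) -> R -> R -> X -> X) (ubar : R -> Rm) (t : R) : X -> R :=
  l \o Phi ubar t T.

Definition hamiltonian (alpha : R) (G : R -> X -> bounded_op Rm X)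
    (p : R -> X -> R) (t : R) (x : X) (v : Rm) : R :=
  alpha / 2 * sqnorm v +
  (v^T *m adjoint (G t x) (fderiv (p t) x)) ord0 ord0.

End ControlSystem.

(* Main.v *)
Require Import Defs.
From HB Require Import structures.
From mathcomp Require Import all_boot all_order all_algebra.
From mathcomp Require Import finmap.
From mathcomp Require Import all_classical all_reals all_analysis.
From mathcomp Require Import measurable_realfun.
From mathcomp Require Import ring lra.

Set Implicit Arguments.
Unset Strict Implicit.
Unset Printing Implicit Defensive.
Import Order.TTheory GRing.Theory Num.Theory.
Import numFieldNormedType.Exports.

Local Open Scope classical_set_scope.
Local Open Scope ring_scope.

(* Bochner integrals are handled through continuous linear functionals only: a
   norming functional (Hahn-Banach) reduces every estimate, and the mean value
   inequality, to the scalar case.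

   Write Psi_t for the flow of ubar from time t to time T.  Gronwall's
   inequality bounds Psi_t(a + b + x) - Psi_t(b + x) - Psi_t(a + x) + Psi_t(x)
   by K |a| |b|, so that Psi_t is differentiable and its derivative need not be
   constructed from a linearised equation.

   Let c(t) = Psi_t(x_t) and P(t) = D Psi_t(x_t).  For s <= t let d be x_t minus
   the state reached at time t by the flow of ubar started from x_s at time s.
   It is the integral over r in [s, t] of S_(t - r) applied to
   G_r(x_r)(u(r) - ubar(r)), up to O((t - s)^2).  Moreover
   c(t) - c(s) = P(t) d + O((t - s)^2) and P(r) = P(t) S_(t - r) + O(t - r),
   uniformly.  Since Dl is uniformly continuous near the compact curve c,
   l(c(t)) - l(c(s)) is the integral over [s, t] of Dl(c) P (G(x)(u - ubar)),
   up to o(t - s).  Summing over finer and finer subdivisions of [0, T] gives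
   both the measurability of this integrand and the formula. *)

(** * Norming functionals *)

Section HahnBanach.
Context {R : realType} {V : normedModType R}.
Implicit Types (p q : V -> R) (x y : V).

(** The operator A is unbounded, so neither x_t nor the map sending t to pbar_t(x) need be
    differentiable in time, and no product rule can be applied to pbar_t(x_t). Comparing increments
    over [s, t] at the common time t avoids A altogether: the kernel S_(t - r) in the formula for d
    is exactly what turns P(t) into P(r).

    Since Psi_T is the identity, c(T) = x_T, while c(0) is the state reached at time T by ubar from
    x_0. The increment of l along c is therefore the terminal part of the cost difference. Both
    fields are evaluated at the same state x_t, so f cancels and only G_t(x_t)(u - ubar) remains. It
    is bounded, which is what makes d of order t - s and its quadratic terms negligible. *)

Definition sublinear p : Prop :=
  (forall x y, p (x + y) <= p x + p y) /\
  (forall c x, 0 < c -> p (c *: x) <= c * p x).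

Lemma sublinear_homogeneous p c x :
  sublinear p -> 0 < c -> p (c *: x) = c * p x.
Proof.
move=> [_ ph] c0; apply/eqP; rewrite eq_le ph//=.
rewrite -ler_pdivlMl//; have := ph c^-1 (c *: x); rewrite invr_gt0 => /(_ c0).
by rewrite scalerA mulVf ?scale1r ?gt_eqF.
Qed.

Lemma sublinear0 p : sublinear p -> p 0 = 0.
Proof.
move=> sp; have := sublinear_homogeneous 0 sp (ltr0n R 2).
rewrite scaler0 => /eqP; rewrite mulr_natl mulr2n -subr_eq0 opprD addrA subrr.
by rewrite sub0r oppr_eq0 => /eqP.
Qed.

Lemma sublinear_opp_ge p x : sublinear p -> - p (- x) <= p x.
Proof.
by move=> sp; rewrite -subr_ge0 opprK -(sublinear0 sp) -[in leLHS](subrr x) sp.1.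
Qed.

(** The term t = 0 is [p x], and at [- y] the term t = 1 is [- p y]. So [slide p y] lies below [p],
    and a [p] that cannot be lowered is odd. *)
Definition slide p y x : R :=
  inf [set p (x + t *: y) - t * p y | t in [set t : R | 0 <= t]].

Lemma slide_has_lbound p y x : sublinear p ->
  has_lbound [set p (x + t *: y) - t * p y | t in [set t : R | 0 <= t]].
Proof.
(* The bound comes from t p(y) = p(t y) <= p(- x) + p(x + t y). *)
move=> sp; exists (- p (- x)) => _ [t /= t0 <-].
have <- : p (t *: y) = t * p y.
  move: t0; rewrite le_eqVlt => /predU1P[<-|t0].
    by rewrite mul0r scale0r sublinear0.
  by rewrite sublinear_homogeneous.
have := sp.1 (- x) (x + t *: y); rewrite addKr; lra.
Qed.

Lemma slide_le p x y t : sublinear p -> 0 <= t ->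
  slide p y x <= p (x + t *: y) - t * p y.
Proof. by move=> sp t0; apply: ge_inf; [exact: slide_has_lbound|exists t]. Qed.

Lemma slide_le_id p x y : sublinear p -> slide p y x <= p x.
Proof.
by move=> sp; have := slide_le x y sp (lexx 0); rewrite scale0r addr0 mul0r subr0.
Qed.

Lemma le_slide p x y a : 
  (forall t, 0 <= t -> a <= p (x + t *: y) - t * p y) -> a <= slide p y x.
Proof.
move=> h; apply: lb_le_inf; first by exists (p (x + 0 *: y) - 0 * p y), 0 => /=.
by move=> _ [t /= t0 <-]; exact: h.
Qed.

Lemma sublinear_slide p y : sublinear p -> sublinear (slide p y).
Proof.
move=> sp; split=> [x z|c x c0].
  (* The two infima are handled one after the other: t is fixed for x, then s for z, and t + s is
     the competitor for x + z. *)
  suff h t : 0 <= t ->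
      slide p y (x + z) - slide p y z <= p (x + t *: y) - t * p y.
    by have := le_slide h; rewrite lerBlDr.
  move=> t0.
  suff h s : 0 <= s ->
      slide p y (x + z) - (p (x + t *: y) - t * p y) <= p (z + s *: y) - s * p y.
    by have := le_slide h; lra.
  move=> s0; have := slide_le (x + z) y sp (addr_ge0 t0 s0).
  rewrite scalerDl addrACA mulrDl.
  have := sp.1 (x + t *: y) (z + s *: y); lra.
rewrite -ler_pdivrMl//; apply: le_slide => t t0; rewrite ler_pdivrMl//.
have := slide_le (c *: x) y sp (mulr_ge0 (ltW c0) t0).
by rewrite -scalerA -scalerDr (sublinear_homogeneous _ sp c0) -mulrA mulrBr.
Qed.

Let dominated (q : V -> R) := {p : V -> R | sublinear p /\ forall x, p x <= q x}.

(** The pointwise infimum serves. It is finite because every member is at least - q(- x) at x. For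
    subadditivity, the smaller of the members chosen at x and at y can be used at both points, which
    is where totality enters. The empty chain is bounded by q. *)
Let chain_bound (q : V -> R) (A : set (dominated q)) :
  sublinear q ->
  total_on A (fun s t => `[< forall x, sval t x <= sval s x >]) ->
  exists t : dominated q,
    forall s, A s -> `[< forall x, sval t x <= sval s x >].
Proof.
move=> sq totA; have [A0|/set0P[a Aa]] := eqVneq A set0.
  by exists (exist _ q (conj sq (fun x => lexx _))) => s; rewrite A0.
pose S x := [set sval s x | s in A].
have Slb x : has_lbound (S x).
  exists (- q (- x)) => _ [s As <-]; case: s As => s [ss sq'] /= _.
  by have := sublinear_opp_ge x ss; have := sq' (- x); lra.
have Sn x : S x !=set0 by exists (sval a x), a.
pose m x := inf (S x).
have mle s x : A s -> m x <= sval s x.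
  by move=> As; apply: ge_inf => //; exists s.
have sm : sublinear m.
  split=> [x y|c x c0].
    suff h s : A s -> m (x + y) - m y <= sval s x.
      have : m (x + y) - m y <= m x.
        by apply: lb_le_inf => // _ [s As <-]; exact: h.
      by lra.
    move=> As; suff : m (x + y) - sval s x <= m y by lra.
    apply: lb_le_inf => // _ [s' As' <-].
    have [/asboolP ss'|/asboolP ss'] := totA _ _ As As'.
      have := mle _ (x + y) As'; have := (svalP s').1.1 x y.
      by have := ss' x; lra.
    have := mle _ (x + y) As; have := (svalP s).1.1 x y.
    by have := ss' y; lra.
  rewrite -ler_pdivrMl//; apply: lb_le_inf => // _ [s As <-].
  rewrite ler_pdivrMl//; apply: le_trans (mle _ _ As) _.
  by rewrite sublinear_homogeneous//; exact: (svalP s).1.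
have mq x : m x <= q x.
  by apply: le_trans (mle _ x Aa) _; exact: (svalP a).2.
by exists (exist _ m (conj sm mq)) => s As; apply/asboolP => x /=; exact: mle.
Qed.

(* A minimal sublinear functional is linear, because replacing it by its
   [slide] in any direction cannot make it smaller. *)
Lemma sublinear_dominates_linear (q : V -> R) : sublinear q ->
  exists f : V -> R, linear (f : V -> R^o) /\ forall x, f x <= q x.
Proof.
move=> sq.
(* The order is reversed, so that the maximal element of Zorn's lemma is a minimal functional. *)
pose Rel (s t : dominated q) := `[< forall x, sval t x <= sval s x >].
have [||||[p [sp pq]] pmin] := @Zorn _ Rel.
- by move=> t; apply/asboolP.
- move=> r s t /asboolP rs /asboolP st; apply/asboolP => x.
  exact: le_trans (st x) (rs x).
- move=> [s sP] [t tP] /asboolP /= st /asboolP /= ts; apply: eq_exist => /=.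
  by apply/funext => x; apply/eqP; rewrite eq_le st ts.
- by move=> A totA; exact: chain_bound.
exists p; split=> //.
have pE y : p (- y) = - p y.
  have sl x : slide p y x <= q x by apply: le_trans (slide_le_id x y sp) (pq x).
  pose s : dominated q := exist _ _ (conj (sublinear_slide y sp) sl).
  have /(congr1 sval)/= spE : s = exist _ p (conj sp pq).
    by apply: pmin; apply/asboolP => x /=; exact: slide_le_id.
  (* By minimality the slide is p itself, and its term t = 1 at - y equals - p(y). *)
  have := slide_le (- y) y sp ler01; rewrite spE scale1r addNr sublinear0//.
  by have := sublinear_opp_ge y sp; lra.
(* Oddness turns subadditivity at - x and - y into superadditivity at x and y. *)
have pD x y : p (x + y) = p x + p y.
  have := sp.1 x y; have := sp.1 (- x) (- y).
  by rewrite -opprD !pE; lra.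
have pZ c x : p (c *: x) = c * p x.
  have [c0|c0|->] := ltgtP c 0; last by rewrite scale0r mul0r sublinear0.
    rewrite -[c *: x]opprK -scaleNr pE sublinear_homogeneous ?oppr_gt0//.
    by rewrite mulNr opprK.
  by rewrite sublinear_homogeneous.
by move=> c x y; rewrite pD pZ.
Qed.

(** The slide of the norm in direction x builds the value at x into the majorant: a linear f below
    it satisfies f(- x) <= |- x + x| - |x|, that is f(x) >= |x|. *)
Lemma norming_functional (x : V) :
  exists p : bounded_op V R, p x = `|x| /\ forall y, `|p y| <= `|y|.
Proof.
pose n := fun y : V => `|y|.
have sn : sublinear n.
  split=> [y z|c y c0]; first exact: ler_normD.
  by rewrite /n normrZ gtr0_norm.
have [f [lf fn]] := sublinear_dominates_linear (sublinear_slide x sn).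
have fZ c y : f (c *: y) = c * f y.
  have f0 : f 0 = 0 by have := lf 1 0 0; rewrite scaler0 addr0 scale1r; lra.
  by have := lf c y 0; rewrite addr0 f0 addr0.
have fN y : f (- y) = - f y by rewrite -scaleN1r fZ mulN1r.
have fle y : `|f y| <= `|y|.
  have h z : f z <= `|z| by apply: le_trans (fn z) (slide_le_id _ _ sn).
  by rewrite ler_norml h andbT lerNl -fN -(normrN y) h.
have fx : f x = `|x|.
  apply/eqP; rewrite eq_le (le_trans (ler_norm _) (fle _))/=.
  have := slide_le (- x) x sn ler01; have := fn (- x).
  by rewrite fN scale1r addNr /n normr0; lra.
have fb : (f : V -> R) \in is_bounded_op.
  apply/asboolP; split=> // y.
  pose F := HB.pack_for {linear V -> R^o} f (GRing.isLinear.Build _ _ _ _ _ lf).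
  apply: (@bounded_linear_continuous R V R^o F).
  by apply/linear_boundedP; near=> r => z; rewrite (le_trans (fle z))// ler_peMl//;
    near: r; exact: nbhs_pinfty_ge.
by exists (BoundedOp fb).
Unshelve. all: by end_near. Qed.

End HahnBanach.

(** * Integrals of functions that are a.e. Borel *)

Section AeIntegral.
Context {d : measure_display} {Omega : measurableType d} {R : realType}.
Variable mu : {measure set Omega -> \bar R}.
Implicit Types (D : set Omega) (f g : Omega -> R).
Import HBNNSimple.

(* No measurability is required: the library's integral of a nonnegative
   function is its lower integral. *)
Lemma ae_le_lower_integral D (f1 f2 : Omega -> \bar R) :
  measurable D ->
  (forall w, D w -> (0 <= f1 w)%E) -> (forall w, D w -> (0 <= f2 w)%E) ->
  {ae mu, forall w, D w -> (f1 w <= f2 w)%E} ->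
  (\int[mu]_(w in D) f1 w <= \int[mu]_(w in D) f2 w)%E.
Proof.
move=> mD f10 f20 [N [mN N0 subN]]; rewrite !ge0_integralE//.
apply/ge_ereal_sup => _ /= [h hf1 <-].
have mNC : measurable (~` N) by exact: measurableC.
(* Cutting h off on the null set N keeps its integral and puts it below f2 everywhere on D. *)
pose h' := proj_nnsfun h mNC.
have -> : sintegral mu h = sintegral mu h'.
  have Th (k : {nnsfun Omega >-> R}) :
      sintegral mu k = (\int[mu]_(x in setT) (k x)%:E)%E.
    by rewrite integral_nnsfun// patch_setT.
  rewrite !Th; apply: ae_eq_integral => //.
  - by apply/measurable_EFinP; exact: measurable_funPT.
  - by apply/measurable_EFinP; exact: measurable_funPT.
  exists N; split => // w /= /not_implyP[_]; apply: contra_notP => Nw.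
  congr EFin; rewrite -[RHS]/(h w * \1_(~` N) w).
  by rewrite indicE mem_set// mulr1.
apply: ereal_sup_ubound; exists h' => // w.
rewrite -[h' w]/(h w * \1_(~` N) w) indicE; have [Nw|Nw] := pselect (N w).
  rewrite memNset ?mulr0; last by move=> /(_ Nw).
  by rewrite /patch; case: ifPn => // /set_mem; exact: f20.
rewrite mem_set ?mulr1//; apply: le_trans (hf1 w) _.
rewrite /patch; case: ifPn => // /set_mem Dw.
by apply: contrapT => f12; apply: Nw; apply: subN => /= /(_ Dw).
Qed.

(** Lebesgue measure lives on the Borel sets here, so an a.e. limit of Borel functions need not be
    measurable. The relation carries an integrable representative, and existence and value of the
    integral travel together. *)
Definition ae_integral D f (a : R) : Prop := exists g,
  [/\ mu.-integrable D (EFin \o g),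
      {ae mu, forall w, D w -> f w = g w} &
      \int[mu]_(w in D) g w = a].

(** The library's integral is the difference of the lower integrals of the positive and negative
    parts, and neither of these sees a null set. *)
Lemma ae_integral_Rintegral D f a : measurable D ->
  ae_integral D f a -> \int[mu]_(w in D) f w = a.
Proof.
move=> mD [g [ig fg <-]]; rewrite /Rintegral; congr fine.
rewrite integralE [in RHS]integralE; congr (_ - _)%E.
  apply/eqP; rewrite eq_le; apply/andP; split;
    apply: ae_le_lower_integral => //; apply: filterS fg => w fg Dw;
    by rewrite !funeposE fg.
apply/eqP; rewrite eq_le; apply/andP; split;
  apply: ae_le_lower_integral => //; apply: filterS fg => w fg Dw;
  by rewrite !funenegE fg.
Qed.

Lemma ae_integral_eq D f f' a : {ae mu, forall w, D w -> f w = f' w} ->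
  ae_integral D f a -> ae_integral D f' a.
Proof.
move=> ff' [g [ig fg ga]]; exists g; split => //.
by apply: filterS2 fg ff' => w h1 h2 Dw; rewrite -h2// h1.
Qed.

Lemma ae_integralD D f f' a a' : measurable D ->
  ae_integral D f a -> ae_integral D f' a' -> ae_integral D (f \+ f') (a + a').
Proof.
move=> mD [g [ig fg <-]] [g' [ig' fg' <-]]; exists (g \+ g'); split => //.
- exact: (integrableD mD ig ig').
- by apply: filterS2 fg fg' => w h1 h2 Dw /=; rewrite h1// h2.
- exact: RintegralD.
Qed.

Lemma ae_integralZ D f a k : measurable D ->
  ae_integral D f a -> ae_integral D (fun w => k * f w) (k * a).
Proof.
move=> mD [g [ig fg <-]]; exists (fun w => k * g w); split => //.
- exact: (integrableZl mD k ig).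
- by apply: filterS fg => w h1 Dw /=; rewrite h1.
- exact: RintegralZl.
Qed.

Lemma ae_integralB D f f' a a' : measurable D ->
  ae_integral D f a -> ae_integral D f' a' -> ae_integral D (f \- f') (a - a').
Proof.
move=> mD [g [ig fg <-]] [g' [ig' fg' <-]]; exists (g \- g'); split => //.
- exact: (integrableB mD ig ig').
- by apply: filterS2 fg fg' => w h1 h2 Dw /=; rewrite h1// h2.
- exact: RintegralB.
Qed.

Lemma ae_integral_bound D f a k : measurable D ->
  ae_integral D f a -> mu.-integrable D (EFin \o k) ->
  (forall w, D w -> 0 <= k w) ->
  {ae mu, forall w, D w -> `|f w| <= k w} ->
  `|a| <= \int[mu]_(w in D) k w.
Proof.
move=> mD [g [ig fg <-]] ik k0 fk; apply: le_trans (le_normr_Rintegral mD ig) _.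
apply: fine_le.
- exact: integrable_fin_num (integrable_norm ig).
- exact: integrable_fin_num.
- apply: ae_le_lower_integral => //.
  by apply: filterS2 fg fk => w h1 h2 Dw; rewrite lee_fin -h1// h2.
Qed.

Lemma ae_integral_subset D D' f a : measurable D -> measurable D' -> D' `<=` D ->
  ae_integral D f a -> exists b, ae_integral D' f b.
Proof.
move=> mD mD' sD [g [ig fg _]]; exists (\int[mu]_(w in D') g w), g; split => //.
- exact: integrableS ig.
- by apply: filterS fg => w h /sD.
Qed.

(** Setting all functions to 0 on the exceptional null set makes the convergence hold everywhere on
    D. *)
Lemma ae_limit_measurable D (f_ : nat -> Omega -> R) f : measurable D ->
  (forall n, measurable_fun D (f_ n)) ->
  {ae mu, forall w, D w -> f_ n w @[n --> \oo] --> f w} ->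
  exists2 g, measurable_fun D g & {ae mu, forall w, D w -> f w = g w}.
Proof.
move=> mD mf [N [mN N0 subN]]; exists (f \_ (~` N)); last first.
  exists N; split => // w /= /not_implyP[Dw]; apply: contra_notP => Nw.
  by rewrite /patch mem_set.
have mNC : measurable (~` N) by exact: measurableC.
apply: (@measurable_fun_cvg _ _ _ _ (fun n => f_ n \_ (~` N))) => [n|w Dw].
  by apply/(measurable_restrict _ _ _).1 => //; apply: measurable_funS (mf n).
rewrite /patch; case: ifPn => [/set_mem Nw|_]; last exact: cvg_cst.
by apply: contrapT => h; apply: Nw; apply: subN => /= /(_ Dw).
Qed.

Lemma finite_range_measurable {Y : normedModType R} D (s : Omega -> Y)
    (phi : Y -> R) :
  measurable D -> bochner_simple mu D s -> measurable_fun D (phi \o s).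
Proof.
move=> mD [fs ms _] _ B mB.
rewrite (_ : _ `&` _ = \bigcup_(y in [set y | range s y /\ B (phi y)])
   (D `&` s @^-1` [set y])).
  apply: fin_bigcup_measurable => //.
  by apply: sub_finite_set fs => y [].
apply/seteqP; split => [w [Dw Bw]|w [y [_ By] [Dw swy]]]; last first.
  by split => //; rewrite /= (swy : s w = y).
by exists (s w) => //; split => //; exists w.
Qed.

Lemma strongly_measurable_comp {Y : normedModType R} D (f : Omega -> Y)
    (phi : Y -> R) :
  measurable D -> continuous phi -> strongly_measurable mu D f ->
  exists2 g, measurable_fun D g & {ae mu, forall w, D w -> phi (f w) = g w}.
Proof.
move=> mD cphi [s_ ss sf].
apply: (@ae_limit_measurable D (fun n => phi \o s_ n)) => //.
  by move=> n; exact: finite_range_measurable.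
by apply: filterS sf => w h /h; apply: continuous_cvg; exact: cphi.
Qed.

Lemma bounded_ae_integral D f g M : measurable D -> (mu D < +oo)%E ->
  measurable_fun D g -> {ae mu, forall w, D w -> f w = g w} ->
  {ae mu, forall w, D w -> `|f w| <= M} ->
  exists a, ae_integral D f a.
Proof.
(* The bound M is only known a.e.; truncation makes the representative bounded at every point. *)
move=> mD Doo mg fg fM; pose g' w := Num.max (- M) (Num.min (g w) M).
exists (\int[mu]_(w in D) g' w), g'; split => //; last first.
  apply: filterS2 fg fM => w h1 h2 Dw; rewrite /g' -h1//.
  have := h2 Dw; rewrite ler_norml => /andP[h3 h4].
  by rewrite min_l// max_r.
have mg' : measurable_fun D g'.
  apply: measurable_maxr; first exact: measurable_cst.
  by apply: measurable_minr => //; exact: measurable_cst.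
apply: measurable_bounded_integrable => //.
exists `|M|; split; first exact: num_real.
move=> x Mx w Dw; apply: le_trans (ltW Mx); rewrite /g'.
rewrite ler_norml; have := ler_norm M; have := ler_norm (- M); rewrite normrN.
by case: (leP (g w) M) => h1;
  [case: (leP (- M) (g w)) => h2|case: (leP (- M) M) => h2];
  move=> *; apply/andP; split; lra.
Qed.

End AeIntegral.

(** * Bochner integrals through functionals *)

Section WeakIntegral.
Context {d : measure_display} {Omega : measurableType d} {R : realType}.
Context {Y : normedModType R}.
Variable mu : {measure set Omega -> \bar R}.
Implicit Types (D : set Omega) (f : Omega -> Y) (p : bounded_op Y R).

(** An integral in the sense of Pettis, over the single set [D]. Functionals separate points by
    [norming_functional], so [v] is determined when [D] is measurable. *)
Definition weak_integral D f (v : Y) : Prop :=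
  forall p, ae_integral mu D (p \o f) (p v).

Lemma weak_integral_bound D f v (k : Omega -> R) : measurable D ->
  weak_integral D f v -> mu.-integrable D (EFin \o k) ->
  (forall w, D w -> 0 <= k w) ->
  {ae mu, forall w, D w -> `|f w| <= k w} ->
  `|v| <= \int[mu]_(w in D) k w.
Proof.
move=> mD fv ik k0 fk; have [p [pv ple]] := norming_functional v.
rewrite -(ger0_norm (normr_ge0 v)) -pv.
apply: (ae_integral_bound mD (fv p)) => //.
by apply: filterS fk => w h Dw; apply: le_trans (ple _) (h Dw).
Qed.

Lemma weak_integral_eq D f f' v : {ae mu, forall w, D w -> f w = f' w} ->
  weak_integral D f v -> weak_integral D f' v.
Proof.
move=> ff' fv p; apply: ae_integral_eq (fv p).
by apply: filterS ff' => w h Dw /=; rewrite h.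
Qed.

Lemma weak_integralB D f f' v v' : measurable D ->
  weak_integral D f v -> weak_integral D f' v' ->
  weak_integral D (f \- f') (v - v').
Proof.
move=> mD fv fv' p; rewrite raddfB; apply: ae_integral_eq (ae_integralB mD (fv p) (fv' p)).
by apply: aeW => w Dw /=; rewrite raddfB.
Qed.

Lemma simple_integral_functional D (s : Omega -> Y) p :
  measurable D -> bochner_simple mu D s ->
  mu.-integrable D (EFin \o (p \o s)) /\
  \int[mu]_(w in D) p (s w) = p (simple_integral mu D s).
Proof.
move=> mD ss; have [fs ms moo] := ss.
pose A y := D `&` s @^-1` [set y].
(* These are the summands of p o s. Only the level set of 0 may have infinite measure; its
   coefficient p(0) vanishes, hence the case splits on y = 0 below. *)
pose F y w := ((p y)%:E * (\1_(A y) w)%:E)%E.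
have iA y : y != 0 -> mu.-integrable D (fun w => (\1_(A y) w)%:E).
  move=> y0; apply/integrableP; split.
    by apply/measurable_EFinP; apply: measurable_indic; exact: ms.
  under eq_integral do rewrite gee0_abs ?lee_fin//.
  rewrite integral_indic//; last exact: ms.
  by rewrite setIidl; [exact: moo|exact: subIsetl].
have iF y : mu.-integrable D (F y).
  have [->|y0] := eqVneq y 0.
    rewrite /F raddf0; apply: (eq_integrable mD (cst 0%E)); last exact: integrable0.
    by move=> w _; rewrite mul0e.
  by apply: integrableZl => //; exact: iA.
have IF y : (\int[mu]_(w in D) F y w = (fine (mu (A y)) * p y)%:E)%E.
  have [->|y0] := eqVneq y 0.
    rewrite raddf0 mulr0 /F raddf0; apply: integral0_eq => w _.
    by rewrite mul0e.
  rewrite integralZl//; last exact: iA.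
  rewrite integral_indic//; last exact: ms.
  rewrite setIidl; last exact: subIsetl.
  by rewrite mulrC EFinM fineK// ge0_fin_numE//; exact: moo.
have sE : {in D, (fun w => \sum_(y <- fset_set (range s)) F y w)%E =1
    EFin \o (p \o s)}.
  move=> w /set_mem Dw /=; rewrite (bigD1_seq (s w)) ?fset_uniq//=; last first.
    by rewrite in_fset_set// mem_set//; exists w.
  rewrite big1 ?adde0 /F; first by rewrite indicE mem_set ?mule1.
  by move=> y ys; rewrite indicE memNset ?mule0// => -[_ /= /esym/eqP]; apply/negP.
have iS : mu.-integrable D (fun w => \sum_(y <- fset_set (range s)) F y w)%E.
  exact: integrable_sum.
split; first exact: (eq_integrable mD _ _ sE iS).
rewrite /Rintegral -(@eq_integral _ _ _ _ _ (EFin \o (p \o s)) _ sE).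
rewrite integral_sum//; under eq_bigr do rewrite IF.
rewrite sumEFin/= /simple_integral fsbig_finite// raddf_sum/=.
by apply: eq_bigr => y _; rewrite linearZ.
Qed.

(** The L1 convergence of the simple functions passes to [p \o f] up to a factor bounding p. A
    single index then gives integrability, and large indices identify the value. *)
Lemma bochner_weak_integral D f v : measurable D ->
  is_bochner_integral mu D f v -> weak_integral D f v.
Proof.
move=> mD [s_ [ss sf sl1 sv]] p. have cp := @bounded_op_continuous _ _ _ p.
have ps n := simple_integral_functional p mD (ss n).
have [g mg fg] : exists2 g, measurable_fun D g &
    {ae mu, forall w, D w -> p (f w) = g w}.
  by apply: (strongly_measurable_comp mD cp); exists s_.
(* The summand 1 keeps C positive even for p = 0, so that one can divide by it. *)
pose C := opnorm p + 1; have C0 : 0 < C by rewrite ltr_wpDl ?opnorm_ge0.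
have pC y : `|p y| <= C * `|y|.
  by apply: le_trans (opnorm_bound p y) _; rewrite ler_wpM2r// lerDl.
have mps n : measurable_fun D (p \o s_ n) by exact: finite_range_measurable.
have gs n : (\int[mu]_(w in D) `|g w - p (s_ n w)|%:E <=
    C%:E * \int[mu]_(w in D) `|f w - s_ n w|%:E)%E.
  rewrite -lee_pdivrMl// -ge0_integralZl//; last 2 first.
  - apply/measurable_EFinP; apply: measurableT_comp => //.
    by apply: measurable_funB => //; exact: mps.
  - by rewrite lee_fin invr_ge0 ltW.
  apply: ae_le_lower_integral => //.
    by move=> w Dw; rewrite lee_fin mulr_ge0// invr_ge0 ltW.
  apply: filterS fg => w h Dw; rewrite -EFinM lee_fin ler_pdivrMl// -h//.
  by rewrite -raddfB pC.
have [fin cv] := (fine_cvgP _ _).1 sl1.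
have small e : 0 < e -> \forall n \near \oo,
    (\int[mu]_(w in D) `|g w - p (s_ n w)|%:E <= (C * e)%:E)%E.
  move=> e0; near=> n; apply: le_trans (gs n) _.
  rewrite EFinM lee_pmul2l// -[leLHS]fineK; last by near: n.
  by rewrite lee_fin; near: n; apply: (cvgr_le 0).
have ig : mu.-integrable D (EFin \o g).
  have [n] : exists n, (\int[mu]_(w in D) `|g w - p (s_ n w)|%:E <= (C * 1)%:E)%E.
    have [N _ h] := small 1 ltr01.
    by exists N; apply: h => /=.
  move=> h.
  have i1 : mu.-integrable D (EFin \o (g \- (p \o s_ n))).
    apply/integrableP; split; first by apply/measurable_EFinP; exact: measurable_funB.
    by apply: le_lt_trans h _; rewrite ltry.
  have := integrableD mD i1 (ps n).1; apply: (eq_integrable mD) => w _ /=.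
  by rewrite -EFinD subrK.
exists g; split => //.
apply/eqP; rewrite -subr_eq0 -normr_le0; apply/ler_addgt0Pl => e e0; rewrite addr0.
near \oo => n.
have h1 : `|\int[mu]_(w in D) g w - p (simple_integral mu D (s_ n))| <= e / 2.
  rewrite -(ps n).2 -RintegralB//; last exact: (ps n).1.
  have i1 : mu.-integrable D (EFin \o (g \- (p \o s_ n))).
    exact: (integrableB mD ig (ps n).1).
  apply: le_trans (le_normr_Rintegral mD i1) _.
  rewrite -lee_fin /Rintegral fineK; last first.
    exact: integrable_fin_num (integrable_norm i1).
  have -> : e / 2 = C * (e / 2 / C) by rewrite mulrCA divff ?mulr1 ?gt_eqF.
  by near: n; apply: small; rewrite !divr_gt0.
have h2 : `|p (simple_integral mu D (s_ n)) - p v| <= e / 2.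
  rewrite distrC; near: n; apply: cvgr_dist_le; last by rewrite divr_gt0.
  by apply: continuous_cvg sv; exact: bounded_op_continuous.
have := ler_distD (p (simple_integral mu D (s_ n))) (\int[mu]_(w in D) g w) (p v).
by move=> h3; apply: le_trans h3 _; rewrite (splitr e) lerD.
Unshelve. all: by end_near. Qed.

End WeakIntegral.

Lemma weak_integral_op {d : measure_display} {Omega : measurableType d}
    {R : realType} {Y Z : normedModType R} (mu : {measure set Omega -> \bar R})
    (D : set Omega) (f : Omega -> Y) (v : Y) (L : bounded_op Y Z) :
  weak_integral mu D f v -> weak_integral mu D (L \o f) (L v).
Proof.
move=> fv p; have pL : (p \o L) \in @is_bounded_op R Y R.
  apply/asboolP; split; first by move=> a x y /=; rewrite !linearP.
  move=> x; apply: continuous_comp; exact: bounded_op_continuous.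
exact: (fv (BoundedOp pL)).
Qed.

(** * Uniform limits of integrands *)

Section AeIntegralApproximation.
Context {d : measure_display} {Omega : measurableType d} {R : realType}.
Variable mu : {measure set Omega -> \bar R}.

(** Measurability of [f] is part of the conclusion: [f] is the a.e. limit of the approximants for e
    = 1 / (n + 1), whose countably many exceptional sets have a null union. *)
Lemma ae_integral_limit (D : set Omega) (f : Omega -> R) (a : R) :
  measurable D -> (mu D < +oo)%E ->
  (forall e, 0 < e -> exists g b, [/\ ae_integral mu D g b,
     {ae mu, forall w, D w -> `|f w - g w| <= e} & `|a - b| <= e]) ->
  ae_integral mu D f a.
Proof.
move=> mD Doo fa.
have {}fa n : exists gb : (Omega -> R) * R, [/\ mu.-integrable D (EFin \o gb.1),
    {ae mu, forall w, D w -> `|f w - gb.1 w| <= n.+1%:R^-1},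
    \int[mu]_(w in D) gb.1 w = gb.2 & `|a - gb.2| <= n.+1%:R^-1].
  have [|g [b [[g' [ig' gg' g'b]] fg ab]]] := fa n.+1%:R^-1.
    by rewrite invr_gt0 ltr0n.
  exists (g', b); split => //=.
  by apply: filterS2 fg gg' => w h1 h2 Dw; rewrite -h2// h1.
have {fa} [g /all_and4[ig fg ga ab]] := choice fa.
have inv0 : n.+1%:R^-1 @[n --> \oo] --> (0 : R).
  exact: cvg_harmonic.
have fg' := ae_foralln fg.
have [h mh fh] : exists2 h, measurable_fun D h &
    {ae mu, forall w, D w -> f w = h w}.
  apply: (@ae_limit_measurable _ _ _ _ _ (fun n => (g n).1)) => //.
    by move=> n; apply/measurable_EFinP; exact: measurable_int (ig n).
  apply: filterS fg' => w hw Dw; apply/cvgrPdist_le => e e0.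
  near=> n; apply: le_trans (hw n Dw) _.
  by near: n; apply: (cvgr_le 0).
have hg n : {ae mu, forall w, D w -> `|h w - (g n).1 w| <= n.+1%:R^-1}.
  by apply: filterS2 (fg n) fh => w h1 h2 Dw; rewrite -h2// h1.
have mB n : measurable_fun D (h \- (g n).1).
  by apply: measurable_funB => //; apply/measurable_EFinP; exact: measurable_int (ig n).
have hgint n : (\int[mu]_(w in D) `|h w - (g n).1 w|%:E <=
     (n.+1%:R^-1 * fine (mu D))%:E)%E.
  rewrite EFinM fineK ?ge0_fin_numE// -integral_cst//.
  apply: ae_le_lower_integral => //.
  - by move=> w _; rewrite lee_fin.
  - by apply: filterS (hg n) => w hw Dw; rewrite lee_fin hw.
have iB n : mu.-integrable D (EFin \o (h \- (g n).1)).
  apply/integrableP; split; first exact/measurable_EFinP.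
  by apply: le_lt_trans (hgint n) _; rewrite ltry.
have ih : mu.-integrable D (EFin \o h).
  have := integrableD mD (iB 0%N) (ig 0%N); apply: (eq_integrable mD) => w _ /=.
  by rewrite -EFinD subrK.
exists h; split => //.
apply/eqP; rewrite -subr_eq0 -normr_le0; apply/ler_addgt0Pl => e e0; rewrite addr0.
have c0 : 0 < fine (mu D) + 1 by rewrite ltr_pwDr ?fine_ge0.
near \oo => n.
have h1 : `|\int[mu]_(w in D) h w - (g n).2| <= n.+1%:R^-1 * fine (mu D).
  rewrite -ga -RintegralB//.
  apply: le_trans (le_normr_Rintegral mD (iB n)) _.
  rewrite -lee_fin /Rintegral fineK; last first.
    exact: integrable_fin_num (integrable_norm (iB n)).
  exact: hgint.
have := ler_distD (g n).2 (\int[mu]_(w in D) h w) a.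
move=> h3; apply: le_trans h3 _.
have h4 := ab n; rewrite distrC in h4.
apply: le_trans (lerD h1 h4) _.
rewrite -[X in _ + X]mulr1 -mulrDr -ler_pdivlMr//.
by near: n; apply: (cvgr_le 0) => //; rewrite divr_gt0.
Unshelve. all: by end_near. Qed.

Lemma ae_integral_unique (D : set Omega) (f : Omega -> R) (a b : R) :
  measurable D -> ae_integral mu D f a -> ae_integral mu D f b -> a = b.
Proof.
by move=> mD /(ae_integral_Rintegral mD) <- /(ae_integral_Rintegral mD) <-.
Qed.

Import HBSimple.

Lemma ae_integral_bochner_integrable (D : set Omega) (f : Omega -> R) (a : R) :
  measurable D -> (mu D < +oo)%E -> ae_integral mu D f a -> bochner_integrable mu D f.
Proof.
move=> mD Doo [g [ig fg _]].
have [s_ [is_ sg sl1]] := approximation_sfun_integrable mD ig.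
have ss n : bochner_simple mu D (s_ n : Omega -> R).
  split; first exact: fimfunP.
    by move=> y; apply: measurableI => //; exact: measurable_sfunP.
  move=> y _; apply: le_lt_trans Doo.
  by rewrite le_measure ?inE//; apply: measurableI => //; exact: measurable_sfunP.
(* For the identity functional, [simple_integral_functional] identifies the Bochner and the Lebesgue
   integral of a simple real function. *)
pose p : bounded_op R R := 
  @BoundedOp R R R idfun (introT (asboolP _) (conj (fun _ _ _ => erefl) (fun x => cvg_id))).
exists (\int[mu]_(w in D) g w), s_; split => //.
- apply: filterS fg => w h Dw; rewrite h//.
  by have /fine_cvgP[] := sg w Dw.
- have -> : (fun n => \int[mu]_(w in D) `|f w - s_ n w|%:E)%E =
    (fun n => \int[mu]_(w in D) `|(EFin \o g) w - (s_ n w)%:E|)%E; last by [].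
  apply/funext => n; apply/eqP; rewrite eq_le; apply/andP; split;
    apply: ae_le_lower_integral => //;
    by apply: filterS fg => w h Dw; rewrite h.
apply/cvgrPdist_le => e e0.
have [fin cv] := (fine_cvgP _ _).1 sl1.
near=> n.
have [h1 h2] := simple_integral_functional p mD (ss n).
rewrite -[simple_integral _ _ _]/(p (simple_integral mu D (s_ n))) -h2 -RintegralB//.
have iB : mu.-integrable D (EFin \o (g \- s_ n)) by exact: (integrableB mD ig h1).
apply: le_trans (le_normr_Rintegral mD iB) _.
have -> : \int[mu]_(w in D) `|(g \- s_ n) w| =
   fine (\int[mu]_(w in D) `|(EFin \o g) w - (s_ n w)%:E|)%E by [].
by near: n; apply: (cvgr_le 0).
Unshelve. all: by end_near. Qed.

End AeIntegralApproximation.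

Lemma ae_integralU {d : measure_display} {Omega : measurableType d} {R : realType}
    (mu : {measure set Omega -> \bar R}) (A B : set Omega) (f : Omega -> R)
    (a b : R) :
  measurable A -> measurable B -> [disjoint A & B] ->
  ae_integral mu A f a -> ae_integral mu B f b -> ae_integral mu (A `|` B) f (a + b).
Proof.
move=> mA mB AB [g [ig fg <-]] [h [ih fh <-]].
have mAB : measurable (A `|` B) by exact: measurableU.
have iA : mu.-integrable (A `|` B) (EFin \o (g \_ A)).
  rewrite -restrict_EFin; apply: (@integrableS _ _ _ _ setT) => //.
  exact/(integrable_mkcond _ mA).
have iB : mu.-integrable (A `|` B) (EFin \o (h \_ B)).
  rewrite -restrict_EFin; apply: (@integrableS _ _ _ _ setT) => //.
  exact/(integrable_mkcond _ mB).
exists (fun w => (g \_ A) w + (h \_ B) w); split.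
- exact: (integrableD mAB iA iB).
- apply: filterS2 fg fh => w h1 h2 [Aw|Bw]; rewrite /patch.
    rewrite mem_set// memNset ?addr0 ?h1// => Bw.
    by move/disj_setPS : AB => /(_ w); apply.
  rewrite [in X in _ = _ + X]mem_set// memNset ?add0r ?h2// => Aw.
  by move/disj_setPS : AB => /(_ w); apply.
rewrite RintegralD// -!Rintegral_mkcondr; congr (_ + _); congr Rintegral.
  by rewrite setIC setIidl//; exact: subsetUl.
by rewrite setIC setIidl//; exact: subsetUr.
Qed.

(** * Integrals over intervals and Gronwall's inequality *)

Section LebesgueIntervals.
Context {R : realType}.
Notation leb := (@lebesgue_measure R).
Implicit Types (r s t : R).

Lemma lebesgue_itv_lty s t : (leb `[s, t] < +oo)%E.
Proof. by rewrite lebesgue_measure_itv/=; case: ifP => _; rewrite ?ltry. Qed.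

Lemma ae_integral_itv_cat s r t (f : R -> R) a b : s <= r -> r <= t ->
  ae_integral leb `[s, r] f a -> ae_integral leb `[r, t] f b ->
  ae_integral leb `[s, t] f (a + b).
Proof.
move=> sr rt fa [g [ig fg gb]].
(* The null point r is left to the first interval, which makes the union disjoint. *)
rewrite (@itv_bndbnd_setU _ _ (BLeft s) (BRight r) (BRight t)) ?bnd_simp//.
apply: ae_integralU => //.
  apply/disj_setPS => x [] /=; rewrite !in_itv/= => /andP[_ xr] /andP[rx _].
  by move: (lt_le_trans rx xr); rewrite ltxx.
have ig' : leb.-integrable `]r, t] (EFin \o g).
  by apply: integrableS ig => //; apply: subset_itvr; rewrite bnd_simp.
exists g; split => //.
  apply: filterS fg => w h wr; apply: h; move: wr => /=.
  by rewrite !in_itv/= => /andP[/ltW -> ->].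
by rewrite Rintegral_itv_obnd_cbnd.
Qed.

Lemma ae_integral_itv_split s r t (f : R -> R) a b : s <= r -> r <= t ->
  ae_integral leb `[s, t] f a -> ae_integral leb `[s, r] f b ->
  ae_integral leb `[r, t] f (a - b).
Proof.
move=> sr rt fa fb.
have [c fc] : exists c, ae_integral leb `[r, t] f c.
  apply: ae_integral_subset fa => //; apply: subset_itvr.
  by rewrite bnd_simp.
suff -> : a - b = c by [].
have := ae_integral_itv_cat sr rt fb fc => h.
by rewrite (ae_integral_unique _ fa h)// addrC addKr.
Qed.

Lemma weak_integral_itv_split (Y : normedModType R) s r t (f : R -> Y) v w :
  s <= r -> r <= t ->
  weak_integral leb `[s, t] f v -> weak_integral leb `[s, r] f w ->
  weak_integral leb `[r, t] f (v - w).
Proof.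
move=> sr rt fv fw p; rewrite raddfB.
exact: ae_integral_itv_split (fv p) (fw p).
Qed.

Lemma itv_bounded_integrable s t (f : R -> R) : continuous f ->
  leb.-integrable `[s, t] (EFin \o f).
Proof.
move=> cf; apply: continuous_compact_integrable; first exact: segment_compact.
exact: continuous_subspaceT.
Qed.

Lemma integral_exp_kernel (A lam k s r : R) : 0 < lam -> s <= r ->
  \int[leb]_(x in `[s, r]) (A * expR (lam * (x - s)) + k) =
  A / lam * (expR (lam * (r - s)) - 1) + k * (r - s).
Proof.
move=> lam0; rewrite le_eqVlt => /predU1P[<-|sr].
  by rewrite set_itv1 Rintegral_set1 !subrr mulr0 expR0 subrr !mulr0 addr0.
pose F x := A / lam * expR (lam * (x - s)) + k * (x - s).
have dF (x : R) : is_derive x (1 : R) F (A * expR (lam * (x - s)) + k).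
  have lin (a : R) : is_derive x (1 : R) (fun x : R => a * (x - s)) a.
    have -> : (fun x => a * (x - s)) = a *: (id - cst s) by [].
    by apply: is_derive_eq; rewrite subr0 /GRing.scale/= mulr1.
  have d1 := @is_derive1_comp _ expR (fun x => lam * (x - s)) _ _ _
    (is_derive_expR _) (lin lam).
  have d2 := @is_deriveD _ _ _ _ _ _ _ _ _ (@is_deriveZ _ _ _ _ (A / lam) _ _ _ d1) (lin k).
  by apply: (is_derive_eq d2); rewrite /GRing.scale/=; field; rewrite gt_eqF.
have cF : continuous F.
  move=> x; apply: differentiable_continuous; apply/derivable1_diffP.
  by case: (dF x).
rewrite /Rintegral (@continuous_FTC2 _ _ F)//.
- by rewrite -EFinB/= /F !subrr !mulr0 expR0; ring.
- apply: continuous_subspaceT => x.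
  apply: cvgD; last exact: cvg_cst.
  apply: cvgM; first exact: cvg_cst.
  apply: (@continuous_comp _ _ _ (fun x => lam * (x - s)) expR); last exact: continuous_expR.
  apply: cvgM; first exact: cvg_cst.
  by apply: cvgB; [exact: cvg_id|exact: cvg_cst].
- split.
  + by move=> x _; case: (dF x).
  + by apply: cvg_at_right_filter; exact: cF.
  + by apply: cvg_at_left_filter; exact: cF.
- by move=> x _; rewrite derive1E; case: (dF x).
Qed.

(* The supremum of [expR (- 2 * L * (x - s)) * `|Z x|] is attained; comparing it
   with the right-hand side absorbs half of it. *)
Lemma gronwall (Y : normedModType R) (s t L c k : R) (Z : R -> Y) :
  0 < L -> 0 <= c -> 0 <= k ->
  {within `[s, t], continuous Z} ->
  (forall r, s <= r <= t -> exists (g : R -> Y) (v : Y),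
     [/\ weak_integral leb `[s, r] g v, `|Z r| <= c + `|v| &
         {ae leb, forall x, x \in `[s, r] -> `|g x| <= L * `|Z x| + k}]) ->
  forall r, s <= r <= t ->
    `|Z r| <= 2 * (c + k * (t - s)) * expR (2 * L * (t - s)).
Proof.
move=> L0 c0 k0 cZ ZE r /andP[sr rt].
have st : s <= t by exact: le_trans rt.
have L20 : 0 < 2 * L by rewrite mulr_gt0.
pose h x := expR (- (2 * L * (x - s))) * `|Z x|.
have ch : {within `[s, t], continuous h}.
  move=> x; apply: (@cvgM _ (subspace `[s, t])).
    apply: (@continuous_subspaceT _ _ `[s, t] (fun x => expR (- (2 * L * (x - s))))).
    move=> y; apply: (@continuous_comp _ _ _ (fun x => - (2 * L * (x - s))) expR);
      last exact: continuous_expR.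
    apply: cvgN; apply: cvgM; first exact: cvg_cst.
    by apply: cvgB; [exact: cvg_id|exact: cvg_cst].
  by apply: (@cvg_norm _ _ (subspace `[s, t])); exact: cZ.
have [r0 r0st hmax] := EVT_max st ch.
pose N := h r0.
have ZN x : x \in `[s, t] -> `|Z x| <= N * expR (2 * L * (x - s)).
  move=> /hmax; rewrite /h expRN mulrC ler_pdivrMr ?expR_gt0//.
have N0 : 0 <= N by rewrite mulr_ge0 ?expR_ge0.
move: r0st; rewrite in_itv/= => /andP[sr0 r0t].
have [|g [v [gv Zv gZ]]] := ZE r0; first by rewrite sr0.
have vle : `|v| <= \int[leb]_(x in `[s, r0]) (L * N * expR (2 * L * (x - s)) + k).
  apply: (weak_integral_bound _ gv) => //.
  - apply: itv_bounded_integrable => y.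
    apply: cvgD; last exact: cvg_cst.
    apply: cvgM; first exact: cvg_cst.
    apply: (@continuous_comp _ _ _ (fun x => 2 * L * (x - s)) expR); last exact: continuous_expR.
    apply: cvgM; first exact: cvg_cst.
    by apply: cvgB; [exact: cvg_id|exact: cvg_cst].
  - by move=> w _; rewrite addr_ge0// !mulr_ge0 ?expR_ge0// ltW.
  move: gZ; apply: (@filterS _ _ (ae_filter_ringOfSetsType leb)) => x gx xs.
  apply: le_trans (gx xs) _.
  rewrite lerD2r -mulrA ler_wpM2l//; first exact: ltW.
  apply: ZN; move: xs => /=; rewrite !in_itv/= => /andP[-> /=].
  by move=> /le_trans; apply.
rewrite integral_exp_kernel// in vle.
have NE : `|Z r0| = N * expR (2 * L * (r0 - s)).
  by rewrite /N /h expRN mulrAC mulVf ?mul1r// gt_eqF ?expR_gt0.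
have e1 : 1 <= expR (2 * L * (r0 - s)).
  by rewrite -[leLHS]expR0 ler_expR mulr_ge0 ?subr_ge0// ltW.
have Nle : N <= 2 * (c + k * (t - s)).
  have kk : k * (r0 - s) <= k * (t - s) by rewrite ler_wpM2l// lerB.
  (* The rate 2 L of the weight is chosen for this factor 1 / 2. With e the exponential at r0 it
     leaves N e <= c + (N / 2) (e - 1) + k (r0 - s). *)
  have LN : L * N / (2 * L) = N / 2 by field; rewrite gt_eqF.
  rewrite LN NE in vle Zv.
  have b0 : 0 <= c + k * (t - s) by rewrite addr_ge0// mulr_ge0// subr_ge0.
  rewrite -[leLHS]mulr1; apply: le_trans (ler_wpM2l N0 e1) _.
  set e := expR _ in vle Zv e1 *. nra.
apply: le_trans (ZN r _) _; first by rewrite in_itv/= sr.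
apply: ler_pM => //.
by rewrite ler_expR ler_wpM2l ?lerB// ltW.
Qed.

End LebesgueIntervals.

(** * Differential calculus *)

Section Calculus.
Context {R : realType}.

Lemma fderiv_unique (V W : normedModType R) (f : V -> W) (x : V)
    (L : bounded_op V W) :
  (forall e, 0 < e -> \forall h \near (0 : V),
     `|f (h + x) - f x - L h| <= e * `|h|) ->
  differentiable f x /\ fderiv f x = L.
Proof.
move=> fL.
have eqo : f \o shift x = cst (f x) + L +o_ (0 : V) id.
  apply/eqaddoP => e e0; apply: filterS (fL e e0) => h /=.
  by rewrite -[(_ - _) h]/(f (h + x) - (f x + L h)) opprD addrA.
have dL : 'd f x = L :> (V -> W).
  by apply: diff_unique => //; exact: bounded_op_continuous.
have df : differentiable f x.
  by apply/diff_locallyP; rewrite dL; split => //; exact: bounded_op_continuous.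
by split => //; apply: val_inj; rewrite /= fderivE.
Qed.

Lemma is_derive_line (V : normedModType R) (F : V -> R) (a v : V) (t : R) :
  differentiable F (t *: v + a) ->
  is_derive t (1 : R) (fun s : R => F (s *: v + a)) (fderiv F (t *: v + a) v).
Proof.
move=> dF; have dF' := @diff_derivable _ _ _ F _ v dF.
have E : (fun h : R => h^-1 *: (F ((h *: (1 : R) + t) *: v + a) - F (t *: v + a))) =
   (fun h : R => h^-1 *: (F (h *: v + (t *: v + a)) - F (t *: v + a))).
  by apply/funext => h; rewrite [h *: 1]mulr1 scalerDl addrA.
have dE : 'D_v F (t *: v + a) = fderiv F (t *: v + a) v.
  by rewrite deriveE// fderivE.
by split; [rewrite /derivable /= E|rewrite -dE /derive /= E].
Qed.

Lemma fderiv_functional (V W : normedModType R) (F : V -> W) (p : bounded_op W R)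
    (x v : V) : differentiable F x ->
  differentiable (p \o F) x /\ fderiv (p \o F) x v = p (fderiv F x v).
Proof.
move=> dF; have cp := @bounded_op_continuous _ _ _ p.
have dp : differentiable p (F x) by exact: linear_differentiable.
have dpF : differentiable (p \o F) x by exact: differentiable_comp.
by split => //; rewrite !fderivE// diff_comp//= diff_lin.
Qed.

(** One application of the mean value theorem to the difference of the two restrictions. Only the
    difference of the derivatives has to be small, which suits both second differences and the
    comparison of F with its linearisation. *)
Lemma mean_value_inequality (V : normedModType R) (F G : V -> R) (a b v : V)
    (C : R) :
  (forall x, differentiable F x) -> (forall x, differentiable G x) ->
  (forall t, 0 <= t <= 1 ->
     `|fderiv F (t *: v + a) v - fderiv G (t *: v + b) v| <= C) ->
  `|(F (v + a) - F a) - (G (v + b) - G b)| <= C.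
Proof.
move=> dF dG FGC.
pose h t := F (t *: v + a) - G (t *: v + b).
have dh (t : R) : is_derive t (1 : R) h
    (fderiv F (t *: v + a) v - fderiv G (t *: v + b) v).
  by have := is_deriveB (is_derive_line (dF (t *: v + a))) (is_derive_line (dG (t *: v + b))).
have ch : {within `[0, 1], continuous h}.
  by apply: derivable_within_continuous => t _; case: (dh t).
have [t t01 ht] := MVT_segment ler01 (fun t _ => dh t) ch.
have -> : F (v + a) - F a - (G (v + b) - G b) = h 1 - h 0.
  by rewrite /h !scale1r !scale0r !add0r; ring.
by rewrite ht subr0 mulr1 FGC//; move: t01; rewrite in_itv.
Qed.

(** This is the form in which the Lipschitz bounds on Df and DG are used: unlike a derivative, it
    can be propagated through the flow directly by Gronwall's inequality. *)
Lemma second_difference (V W : normedModType R) (F : V -> W) (M : R) :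
  (forall x, differentiable F x) ->
  (forall x y, `|fderiv F x - fderiv F y| <= M * `|x - y|) ->
  forall x a b, `|F (a + (b + x)) - F (b + x) - (F (a + x) - F x)| <=
                M * `|b| * `|a|.
Proof.
move=> dF FM x a b.
have [p [pE ple]] := norming_functional (F (a + (b + x)) - F (b + x) - (F (a + x) - F x)).
rewrite -[leLHS]ger0_norm// -pE raddfB [X in X - _]raddfB [X in _ - X]raddfB.
apply: (@mean_value_inequality V (p \o F) (p \o F) (b + x) x a).
- by move=> y; apply: (fderiv_functional p 0 _).1.
- by move=> y; apply: (fderiv_functional p 0 _).1.
move=> t _; rewrite !(fderiv_functional _ _ _).2// -raddfB/=.
apply: le_trans (ple _) _.
rewrite -[_ - _]/((fderiv F (t *: a + (b + x)) - fderiv F (t *: a + x)) a).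
apply: le_trans (opnorm_bound _ _) _; rewrite ler_wpM2r//.
apply: le_trans (FM _ _) _.
by rewrite opprD addrACA subrr add0r addrK.
Qed.

Lemma strict_derivative (V : normedModType R) (F : V -> R) (x y : V) (e : R) :
  (forall z, differentiable F z) ->
  (forall z, `|z - x| <= `|y - x| -> `|fderiv F z - fderiv F x| <= e) ->
  `|F y - F x - fderiv F x (y - x)| <= e * `|y - x|.
Proof.
move=> dF Fe; set L := fderiv F x.
have dL z : differentiable L z by apply: linear_differentiable; exact: bounded_op_continuous.
have LE z : fderiv L z = L.
  apply: val_inj; rewrite /= fderivE// diff_lin//; exact: bounded_op_continuous.
(* The second function is the derivative at x itself, which is its own derivative everywhere. *)
have := @mean_value_inequality V F L x 0 (y - x) (e * `|y - x|) dF dL.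
rewrite raddf0 subr0 addr0 subrK; apply => t /andP[t0 t1].
rewrite LE -[_ - _]/((fderiv F (t *: (y - x) + x) - L) (y - x)).
apply: le_trans (opnorm_bound _ _) _; rewrite ler_wpM2r//.
by apply: Fe; rewrite addrK normrZ ger0_norm// ler_piMl.
Qed.

(** Additivity gives homogeneity for natural factors. Hence n times the defect at r is the defect at
    the fractional part of n r, which is bounded by 2 C |x| for every n. *)
Lemma additive_bounded_homogeneous (V W : normedModType R) (f : V -> W) (C : R) :
  {morph f : x y / x + y} -> (forall x, `|f x| <= C * `|x|) ->
  forall r x, f (r *: x) = r *: f x.
Proof.
move=> fD fC.
have f0 : f 0 = 0 by apply: (addrI (f 0)); rewrite -fD !addr0.
have fN x : f (- x) = - f x by apply: (addrI (f x)); rewrite -fD !subrr.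
have fn n x : f (n%:R *: x) = n%:R *: f x.
  elim: n => [|n ih]; first by rewrite !scale0r.
  by rewrite -natr1 !scalerDl fD ih !scale1r.
suff pos r x : 0 <= r -> f (r *: x) = r *: f x.
  move=> r x; have [/ltW|] := ltP r 0; last exact: pos.
  by rewrite -oppr_ge0 => r0; rewrite -[r]opprK scaleNr fN pos// -scaleNr.
move=> r0; apply/eqP; rewrite -subr_eq0 -normr_le0.
have C0 : 0 <= C * `|x| by apply: le_trans (fC x).
have bnd n : n%:R * `|f (r *: x) - r *: f x| <= 2 * (C * `|x|).
  have nr0 : 0 <= n%:R * r by rewrite mulr_ge0.
  have /andP[t1 t2] := truncn_itv nr0.
  set k := Num.truncn _ in t1 t2; set s := n%:R * r - k%:R.
  have s0 : 0 <= s by rewrite subr_ge0.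
  have s1 : s <= 1 by rewrite lerBlDl natr1 ltW.
  have nE : n%:R * r = k%:R + s by rewrite /s addrC subrK.
  have -> : n%:R * `|f (r *: x) - r *: f x| = `|f (s *: x) - s *: f x|.
    rewrite -[X in X * _]ger0_norm// -normrZ scalerBr -fn !scalerA nE.
    by rewrite !scalerDl fD fn opprD addrACA subrr add0r.
  rewrite mulr_natl mulr2n; apply: le_trans (ler_normB _ _) _; apply: lerD.
    apply: le_trans (fC _) _; rewrite normrZ ger0_norm// mulrCA.
    by rewrite ler_piMl.
  by rewrite normrZ ger0_norm// (le_trans _ (fC x))// ler_piMl.
rewrite leNgt; apply/negP => d0.
have := bnd (Num.truncn (2 * (C * `|x|) / `|f (r *: x) - r *: f x|)).+1.
rewrite -ler_pdivlMr//; apply/negP; rewrite -ltNge.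
by have /andP[] := truncn_itv (divr_ge0 (mulr_ge0 (ler0n R 2) C0) (ltW d0)).
Qed.

End Calculus.

(* The dyadic difference quotients form a Cauchy sequence. *)
Lemma differentiable_of_second_difference {R : realType} (V : normedModType R)
    (W : completeNormedModType R) (Psi : V -> W) (C K : R) :
  (forall x y, `|Psi x - Psi y| <= C * `|x - y|) ->
  (forall x a b, `|Psi (a + (b + x)) - Psi (b + x) - (Psi (a + x) - Psi x)| <=
                 K * `|b| * `|a|) ->
  forall x, [/\ differentiable Psi x,
    forall a, `|Psi (a + x) - Psi x - fderiv Psi x a| <= K * `|a| ^+ 2 &
    forall a, `|fderiv Psi x a| <= C * `|a|].
Proof.
move=> lip sd x.
(* For K < 0 the second hypothesis with b = a forces V = 0. *)
have [K0|K0] := ltP K 0.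
  have V0 (a : V) : a = 0.
    apply/eqP; rewrite -normr_eq0; apply/negPn/negP => a0.
    have := le_trans (normr_ge0 _) (sd x a a).
    by rewrite -mulrA nmulr_rge0// leNgt mulr_gt0// lt_def a0 normr_ge0.
  have [] := @fderiv_unique _ _ _ Psi x 0.
    move=> e e0; near=> h; rewrite (V0 h) add0r subrr sub0r normrN.
    by rewrite raddf0 !normr0 mulr0.
  move=> dP ->; split => // a; rewrite (V0 a).
    by rewrite add0r subrr sub0r normrN raddf0 !normr0 expr0n mulr0.
  by rewrite raddf0 !normr0 mulr0.
pose D n a := (2 ^+ n) *: (Psi ((2 ^+ n)^-1 *: a + x) - Psi x).
have p2 n : 0 < 2 ^+ n :> R by rewrite exprn_gt0.
have h2 n : (2 ^+ n.+1)^-1 = (2 ^+ n)^-1 / 2 :> R by rewrite exprSr invfM mulrC.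
have Ka0 a : 0 <= K * `|a| ^+ 2 by rewrite mulr_ge0// exprn_ge0.
(* With both increments equal to b, half of the n-th step, the second difference gives K |a|^2
   2^(-n) / 4. The weaker bound is written as a difference so that it telescopes. *)
have D1 n a : `|D n.+1 a - D n a| <= K * `|a| ^+ 2 * ((2 ^+ n)^-1 - (2 ^+ n.+1)^-1).
  set b := (2 ^+ n.+1)^-1 *: a.
  have bb : (2 ^+ n)^-1 *: a = b + b by rewrite -scalerDl h2 -splitr.
  have -> : D n.+1 a - D n a = - (2 ^+ n *:
      (Psi (b + (b + x)) - Psi (b + x) - (Psi (b + x) - Psi x))).
    rewrite /D bb -/b -addrA exprSr -scalerA -scalerBr -scalerN; congr (_ *: _).
    rewrite -[_ - Psi x in X in _ - X](subrKA (Psi (b + x))).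
    have zz (P Q : W) : P + P - (Q + P) = - (Q - P).
      by rewrite [Q + P]addrC addrKA opprB.
    by rewrite scaler_nat mulr2n; exact: zz.
  rewrite normrN normrZ gtr0_norm//.
  apply: le_trans (ler_wpM2l (ltW (p2 n)) (sd x b b)) _.
  rewrite /b normrZ gtr0_norm ?invr_gt0// h2.
  have -> : 2 ^+ n * (K * ((2 ^+ n)^-1 / 2 * `|a|) * ((2 ^+ n)^-1 / 2 * `|a|)) =
      K * `|a| ^+ 2 * ((2 ^+ n)^-1 / 4).
    by field; rewrite gt_eqF.
  rewrite ler_wpM2l//; have : 0 <= (2 ^+ n)^-1 :> R by rewrite invr_ge0 ltW.
  lra.
have Dnk n k a : `|D (n + k)%N a - D n a| <=
    K * `|a| ^+ 2 * ((2 ^+ n)^-1 - (2 ^+ (n + k))^-1).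
  elim: k => [|k ih]; first by rewrite addn0 !subrr normr0 mulr0.
  apply: le_trans (ler_distD (D (n + k)%N a) _ _) _.
  rewrite addnS; apply: le_trans (lerD (D1 _ _) ih) _.
  by rewrite -mulrDr addrC subrKA.
have Dnm n m a : (n <= m)%N -> `|D m a - D n a| <= K * `|a| ^+ 2 * (2 ^+ n)^-1.
  move=> nm; rewrite -(subnKC nm); apply: le_trans (Dnk _ _ _) _.
  by rewrite ler_wpM2l// lerBlDr lerDl invr_ge0 ltW.
have vanish (M e : R) : 0 < e -> \forall n \near \oo, M * (2 ^+ n)^-1 < e.
  move=> e0; have : M * (2 ^+ n)^-1 @[n --> \oo] --> M * 0.
    apply: cvgM; first exact: cvg_cst.
    have -> : (fun n => (2 ^+ n)^-1) = (fun n => 2^-1 ^+ n) :> (nat -> R).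
      by apply/funext => n; rewrite exprVn.
    by apply: cvg_expr; rewrite gtr0_norm ?invr_gt0// invf_lt1// ltr1n.
  by rewrite mulr0 => /(cvgr_lt 0); apply.
have cvD a : cvg (D n a @[n --> \oo]).
  apply/cauchy_cvgP; apply: cauchy_exP => e e0.
  have [n _ hn] := vanish (K * `|a| ^+ 2) e e0.
  exists (D n a); exists n => // m nm.
  rewrite -ball_normE /= distrC; apply: le_lt_trans (Dnm _ _ _ nm) _.
  by apply: hn => /=.
pose L a := lim (D n a @[n --> \oo]).
have LD n a : `|L a - D n a| <= K * `|a| ^+ 2 * (2 ^+ n)^-1.
  apply/ler_addgt0Pr => e e0; near \oo => m.
  rewrite -(subrKA (D m a)); apply: le_trans (ler_normD _ _) _.
  rewrite [leRHS]addrC; apply: lerD; last by apply: Dnm; near: m; exists n.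
  by near: m; apply: cvgr_dist_le => //; exact: cvD.
have small_eq0 (y : W) (M : R) : (forall n, `|y| <= M * (2 ^+ n)^-1) -> y = 0.
  move=> yM; apply/eqP; rewrite -normr_le0 leNgt; apply/negP => y0.
  have [n _ hn] := vanish M _ y0.
  by have := hn n (leqnn n); rewrite ltNge yM.
have DC n a : `|D n a| <= C * `|a|.
  rewrite /D normrZ gtr0_norm// -ler_pdivlMl//; apply: le_trans (lip _ _) _.
  by rewrite addrK normrZ gtr0_norm ?invr_gt0// mulrCA.
have LC a : `|L a| <= C * `|a|.
  apply/ler_addgt0Pl => e e0.
  have [n _ hn] := vanish (K * `|a| ^+ 2) e e0.
  rewrite -[L a](subrK (D n a)); apply: le_trans (ler_normD _ _) _.
  by apply: lerD (DC n a); apply: le_trans (LD n a) _; apply/ltW/hn => /=.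
(* The failure of additivity of a difference quotient is again a second difference, hence of order
   2^(-n). *)
have Dadd n a b : `|D n (a + b) - (D n a + D n b)| <= K * `|b| * `|a| * (2 ^+ n)^-1.
  rewrite /D -scalerDr -scalerBr normrZ gtr0_norm//.
  set a' := _ *: a; set b' := _ *: b.
  have -> : Psi ((2 ^+ n)^-1 *: (a + b) + x) - Psi x -
       (Psi (a' + x) - Psi x + (Psi (b' + x) - Psi x)) =
     Psi (a' + (b' + x)) - Psi (b' + x) - (Psi (a' + x) - Psi x).
    have zz (P x0 A B : W) : P - x0 - (A - x0 + (B - x0)) = P - B - (A - x0).
      by rewrite [A - _ + _]addrC opprD addrA [- (B - _)]opprB subrKA.
    by rewrite scalerDr -[_ + _ + x]addrA; exact: zz.
  apply: le_trans (ler_wpM2l (ltW (p2 n)) (sd x a' b')) _.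
  rewrite /a' /b' !normrZ gtr0_norm ?invr_gt0//.
  rewrite le_eqVlt; apply/orP; left; apply/eqP; field.
  by rewrite gt_eqF.
have Ladd : {morph L : a b / a + b}.
  move=> a b; apply/eqP; rewrite -subr_eq0; apply/eqP.
  apply: (small_eq0 _ (K * `|a + b| ^+ 2 +
    (K * `|b| * `|a| + (K * `|a| ^+ 2 + K * `|b| ^+ 2)))) => n.
  have -> : L (a + b) - (L a + L b) = (L (a + b) - D n (a + b)) +
     ((D n (a + b) - (D n a + D n b)) + ((D n a - L a) + (D n b - L b))).
    by rewrite [D n a - _ + _]addrACA -opprD !subrKA.
  rewrite !mulrDl; apply: le_trans (ler_normD _ _) _; apply: lerD => //.
  apply: le_trans (ler_normD _ _) _; apply: lerD => //.
  by apply: le_trans (ler_normD _ _) _; apply: lerD; rewrite distrC.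
have LZ := additive_bounded_homogeneous Ladd LC.
have Lb : L \in @is_bounded_op R V W.
  have Ll : linear L by move=> c a b; rewrite Ladd LZ.
  apply/asboolP; split=> //.
  pose F := HB.pack_for {linear V -> W} L (GRing.isLinear.Build _ _ _ _ _ Ll).
  move=> y; apply: (@bounded_linear_continuous R V W F).
  apply/linear_boundedP; near=> r => z; apply: le_trans (LC z) _.
  by rewrite ler_wpM2r//; near: r; exact: nbhs_pinfty_ge.
(* The estimate of the limit at index 0 is already the quadratic remainder. *)
have LP a : `|Psi (a + x) - Psi x - L a| <= K * `|a| ^+ 2.
  have := LD 0%N a; rewrite /D expr0 invr1 mulr1 !scale1r => h.
  by rewrite distrC.
have [] := @fderiv_unique _ _ _ Psi x (BoundedOp Lb).
  move=> e e0; have [K1|K1] := eqVneq K 0.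
    by near=> h; apply: le_trans (LP h) _; rewrite K1 mul0r mulr_ge0// ltW.
  have {}K0 : 0 < K by rewrite lt_def K1.
  near=> h; apply: le_trans (LP h) _; rewrite expr2 mulrA ler_wpM2r//.
  rewrite -ler_pdivlMl//; near: h; apply/nbhs_norm0P.
  by exists (K^-1 * e) => /=; [rewrite mulr_gt0 ?invr_gt0|move=> h /ltW].
by move=> dP ->; split.
Unshelve. all: by end_near. Qed.

(** * Mild solutions *)

Section SemigroupBound.
Context {R : realType} {X : completeNormedModType R}.
Variable S : R -> bounded_op X X.
Hypothesis S_semigroup : C0_semigroup S.

Let S_near0 (x : X) : exists2 d : R, 0 < d &
  forall t, 0 <= t < d -> `|S t x| <= `|x| + 1.
Proof.
have [S0 _ Sc] := S_semigroup.
have [d /= d0 hd] : \forall t \near 0^'+, `|S t x| <= `|x| + 1.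
  have := Sc x => /cvgrPdist_le/(_ 1 ltr01); apply: filterS => t h.
  rewrite -[S t x](subrKC x) (le_trans (ler_normD _ _))// lerD2l.
  by rewrite distrC.
exists d => // t /andP[]; rewrite le_eqVlt => /predU1P[<-|t0 td].
  by rewrite S0 lerDl.
by apply: hd => //; rewrite /= sub0r normrN gtr0_norm.
Qed.

(** Otherwise there are times t_n <= 1 / (n + 1) at which S has norm above n + 1. Continuity at 0
    makes these operators pointwise bounded, against the Banach-Steinhaus theorem. *)
Let S_local_bound : exists d : R, exists M : R,
  [/\ 0 < d, 1 <= M & forall t x, 0 <= t <= d -> `|S t x| <= M * `|x|].
Proof.
apply: contrapT => nloc.
have bad (n : nat) : exists tx : R * X,
    0 <= tx.1 <= n.+1%:R^-1 /\ n.+1%:R * `|tx.2| < `|S tx.1 tx.2|.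
  apply: contrapT => nbad; apply: nloc; exists n.+1%:R^-1, n.+1%:R; split.
  - by rewrite invr_gt0.
  - by rewrite ler1n.
  move=> t x t0; rewrite leNgt; apply/negP => h; apply: nbad.
  by exists (t, x).
have {bad} [tx /all_and2[tx0 txS]] := choice bad.
pose F : set (X -> X) := [set f : X -> X | exists n, f = S (tx n).1 :> (X -> X)].
have Fb : pointwise_bounded F.
  move=> x; have [d d0 hd] := S_near0 x.
  have [N _ hN] : \forall n \near \oo, n.+1%:R^-1 < d.
    have := @cvg_harmonic R => /cvgrPdist_lt/(_ _ d0); apply: filterS => n.
    by rewrite sub0r normrN ger0_norm// invr_ge0.
  (* The sum covers the finitely many indices whose time may exceed d. *)
  exists (`|x| + 1 + \sum_(i < N) `|S (tx i).1 x|) => _ [n ->].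
  have [nN|Nn] := ltnP n N.
    rewrite (bigD1 (Ordinal nN))//= addrCA lerDl !addr_ge0//.
    by rewrite sumr_ge0.
  rewrite (le_trans (hd _ _))//; last by rewrite lerDl sumr_ge0.
  have /andP[-> h] := tx0 n.
  exact: le_lt_trans h (hN n Nn).
have FL f : F f -> bounded_fun_norm f /\ linear f.
  move=> [n ->]; split; last exact: bounded_op_linear.
  move=> r; exists (opnorm (S (tx n).1) * `|r|) => x xr.
  apply: le_trans (opnorm_bound _ _) _; rewrite ler_wpM2l ?opnorm_ge0//.
  by rewrite (le_trans xr) ?ler_norm.
have [M hM] := Banach_Steinhauss FL Fb 1.
pose n := Num.truncn M.
have Mn : M <= n.+1%:R.
  have [M0|M0] := leP 0 M; first by have /andP[_ /ltW] := truncn_itv M0.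
  by rewrite (le_trans (ltW M0)).
have := txS n; apply/negP; rewrite -leNgt.
apply: le_trans (opnorm_bound _ _) _; rewrite ler_wpM2r//.
by apply: opnorm_le => x x1; apply: le_trans Mn; apply: hM => //; exists n.
Qed.

(** Each step of length d costs one factor M, and more than T / d steps suffice; M >= 1 makes the
    powers of M increase. *)
Lemma C0_semigroup_bound (T : R) : exists2 M : R, 1 <= M &
  forall t x, 0 <= t <= T -> `|S t x| <= M * `|x|.
Proof.
have [S0 SD _] := S_semigroup.
have [d [M [d0 M1 hM]]] := S_local_bound.
have M0 : 0 <= M by exact: le_trans M1.
have Mn1 n : 1 <= M ^+ n by exact: exprn_ege1.
have step n : forall t x, 0 <= t <= n%:R * d -> `|S t x| <= M ^+ n * `|x|.
  elim: n => [|n ih] t x.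
    rewrite mul0r => /andP[t0 t1]; have -> : t = 0 by lra.
    by rewrite S0 expr0 mul1r.
  rewrite -natr1 mulrDl mul1r => /andP[t0 tn]; have [td|td] := leP t d.
    apply: le_trans (hM _ _ _) _; first by rewrite t0.
    by rewrite ler_wpM2r// exprS ler_peMr.
  have -> : t = d + (t - d) by rewrite addrC subrK.
  have td0 : 0 <= t - d by rewrite subr_ge0 ltW.
  have d1 : 0 <= d by exact: ltW.
  rewrite SD//; apply: le_trans (hM _ _ _) _; first by rewrite lexx d1.
  rewrite exprS -mulrA ler_wpM2l//; apply: ih.
  by rewrite td0 lerBlDr.
exists (M ^+ (Num.truncn (T / d)).+1) => // t x /andP[t0 tT].
apply: step; rewrite t0/= -ler_pdivrMr//; apply: le_trans (_ : T / d <= _).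
  by rewrite ler_pM2r ?invr_gt0.
have [T0|T0] := leP 0 (T / d); first by have /andP[_ /ltW] := truncn_itv T0.
by rewrite (le_trans (ltW T0)).
Qed.

End SemigroupBound.

Section MildEquation.
Context {R : realType} {X : completeNormedModType R}.
Notation leb := (@lebesgue_measure R).
Variables (S : R -> bounded_op X X) (T MS : R).
Hypothesis S_semigroup : C0_semigroup S.
Hypothesis MS1 : 1 <= MS.
Hypothesis S_bound : forall t x, 0 <= t <= T -> `|S t x| <= MS * `|x|.
Implicit Types (s r t : R) (g Z : R -> X) (z : X).

Let MS0 : 0 <= MS. Proof. exact: le_trans MS1. Qed.

Lemma weak_integral_set1 t g v : weak_integral leb `[t, t] g v -> v = 0.
Proof.
move=> gv; apply/eqP; rewrite -normr_le0.
have -> : 0 = \int[leb]_(w in `[t, t]) `|g t| :> R.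
  by rewrite set_itv1 Rintegral_set1.
apply: (weak_integral_bound _ gv) => //.
  by apply: itv_bounded_integrable; exact: cst_continuous.
apply: aeW => w; rewrite set_itv1 => ->.
by [].
Qed.

Lemma weak_integral_cst_bound s t g v B : s <= t -> 0 <= B ->
  weak_integral leb `[s, t] g v ->
  {ae leb, forall x, x \in `[s, t] -> `|g x| <= B} ->
  `|v| <= B * (t - s).
Proof.
move=> st B0 gv gB.
have -> : B * (t - s) = \int[leb]_(w in `[s, t]) B.
  rewrite Rintegral_cst//; congr (_ * _).
  transitivity (fine (leb [set` `[s, t]])); last by [].
  rewrite lebesgue_measure_itv/= lte_fin.
  case: ltP => // ts; have -> : s = t by apply/eqP; rewrite eq_le st.
  by rewrite subrr.
apply: (weak_integral_bound _ gv) => //.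
by apply: itv_bounded_integrable; exact: cst_continuous.
Qed.

(** Here [g] is a function of time alone, a nonlinear field being already evaluated along [Z]. The
    relation is thus linear in [g], [z] and [Z], and differences of solutions of different equations
    satisfy it again. *)
Definition mild s t g z Z : Prop :=
  {within `[s, t], continuous Z} /\
  forall r, s <= r <= t ->
    weak_integral leb `[s, r] (fun x => S (r - x) (g x)) (Z r - S (r - s) z).

Lemma mildB s t g z Z g' z' Z' :
  mild s t g z Z -> mild s t g' z' Z' ->
  mild s t (fun x => g x - g' x) (z - z') (fun x => Z x - Z' x).
Proof.
move=> [cZ iZ] [cZ' iZ']; split.
  move=> x; apply: (@cvgB _ _ (subspace `[s, t])); [exact: cZ|exact: cZ'].
move=> r rst; have := weak_integralB (_ : measurable _) (iZ r rst) (iZ' r rst).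
move=> /(_ (measurable_itv _)).
have -> : Z r - S (r - s) z - (Z' r - S (r - s) z') =
    Z r - Z' r - S (r - s) (z - z').
  by rewrite [S (r - s) (z - _)]raddfB !opprD !opprK addrACA.
by apply: weak_integral_eq; apply: aeW => w _ /=; rewrite raddfB.
Qed.

Lemma mild_sub s t t' g z Z : t' <= t -> mild s t g z Z -> mild s t' g z Z.
Proof.
move=> t't [cZ iZ]; split; last first.
  by move=> r /andP[sr rt]; apply: iZ; rewrite sr (le_trans rt).
by apply: continuous_subspaceW cZ; apply: subset_itvl; rewrite bnd_simp.
Qed.

Lemma mild_initial s t g z Z : s <= t -> mild s t g z Z -> Z s = z.
Proof.
move=> st [_ /(_ s)]; rewrite lexx st => /(_ isT) /weak_integral_set1/eqP.
by rewrite subr_eq0 subrr; have [-> _ _] := S_semigroup => /eqP.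
Qed.

Lemma mild_restart s r t g z Z : s <= r -> r <= t ->
  mild s t g z Z -> mild r t g (Z r) Z.
Proof.
move=> sr rt [cZ iZ]; split.
  by apply: continuous_subspaceW cZ; apply: subset_itvr; rewrite bnd_simp.
move=> q /andP[rq qt]; have [_ SD _] := S_semigroup.
have hq := iZ q _; have hr := iZ r _.
(* Applying S (q - r) to the equation at time r gives the part over [s, r] of the equation at time
   q, which is then subtracted. *)
have {}hr : weak_integral leb `[s, r] (fun x => S (q - x) (g x))
    (S (q - r) (Z r - S (r - s) z)).
  have := weak_integral_op (S (q - r)) (hr _); rewrite sr rt => /(_ isT).
  apply: weak_integral_eq; apply: aeW => x /=; rewrite in_itv/= => /andP[sx xr].
  by rewrite -SD ?subr_ge0// subrKA.
have := weak_integral_itv_split sr rq (hq _) hr.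
rewrite (le_trans sr rq) qt => /(_ isT); congr weak_integral.
rewrite [S _ (_ - _)]raddfB /= -SD ?subr_ge0// subrKA opprB.
by rewrite subrKA.
Qed.

(** With k = 0 this yields uniqueness and Lipschitz dependence on the data; k is the source term
    when second differences or deviations from the flow are estimated. *)
Lemma mild_gronwall s t g z Z L k : 0 <= s -> t <= T -> 0 < L -> 0 <= k ->
  mild s t g z Z ->
  {ae leb, forall x, x \in `[s, t] -> `|g x| <= L * `|Z x| + k} ->
  forall r, s <= r <= t ->
    `|Z r| <= 2 * MS * expR (2 * (MS * L) * T) * (`|z| + k * (t - s)).
Proof.
move=> s0 tT L0 k0 [cZ iZ] gZ r /andP[sr rt].
have st := le_trans sr rt.
have ML : 0 < MS * L by rewrite mulr_gt0// (lt_le_trans ltr01).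
have := @gronwall R X s t (MS * L) (MS * `|z|) (MS * k) Z ML.
rewrite !mulr_ge0// => /(_ isT isT cZ) h.
have {}h : `|Z r| <= 2 * (MS * `|z| + MS * k * (t - s)) * expR (2 * (MS * L) * (t - s)).
  apply: h; last by rewrite sr.
  move=> q /andP[sq qt].
  exists (fun x => S (q - x) (g x)), (Z q - S (q - s) z); split.
  - by apply: iZ; rewrite sq.
  - have := ler_normD (Z q - S (q - s) z) (S (q - s) z); rewrite subrK.
    have : `|S (q - s) z| <= MS * `|z|.
      by apply: S_bound; apply/andP; split; lra.
    lra.
  move: gZ; apply: (@filterS _ _ (ae_filter_ringOfSetsType leb)) => x gx.
  rewrite in_itv/= => /andP[sx xq].
  apply: (@le_trans _ _ (MS * `|g x|)).
    rewrite S_bound// subr_ge0 xq/= lerBlDr.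
    by rewrite (le_trans qt)// (le_trans tT)// lerDl (le_trans s0).
  rewrite -!mulrA -mulrDr ler_wpM2l//; apply: gx.
  by rewrite in_itv/= sx (le_trans xq).
apply: le_trans h _.
have -> : 2 * (MS * `|z| + MS * k * (t - s)) = 2 * MS * (`|z| + k * (t - s)) by ring.
rewrite mulrAC ler_wpM2r//.
  by rewrite addr_ge0// mulr_ge0// subr_ge0.
rewrite ler_wpM2l ?mulr_ge0// ler_expR ler_wpM2l//; first by rewrite mulr_ge0// ltW.
by rewrite lerBlDr (le_trans tT)// lerDl.
Qed.

Lemma mild_bound s t g z Z B : 0 <= s -> t <= T -> 0 <= B ->
  mild s t g z Z ->
  {ae leb, forall x, x \in `[s, t] -> `|g x| <= B} ->
  forall r, s <= r <= t -> `|Z r - S (r - s) z| <= MS * B * (r - s).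
Proof.
move=> s0 tT B0 [cZ iZ] gB r /andP[sr rt].
apply: (weak_integral_cst_bound sr _ (iZ r _)); rewrite ?mulr_ge0 ?sr//.
move: gB; apply: (@filterS _ _ (ae_filter_ringOfSetsType leb)) => x gx.
rewrite in_itv/= => /andP[sx xr].
apply: (@le_trans _ _ (MS * `|g x|)).
  rewrite S_bound// subr_ge0 xr/= lerBlDr.
  by rewrite (le_trans rt)// (le_trans tT)// lerDl (le_trans s0).
by rewrite ler_wpM2l//; apply: gx; rewrite in_itv/= sx (le_trans xr).
Qed.

End MildEquation.

Section BoundedOpArithmetic.
Context {R : realType} {V W : normedModType R}.
Implicit Types (p q : bounded_op V W) (x y : V).

Lemma bounded_op_subE p q x : (p - q) x = p x - q x.
Proof. by []. Qed.

Lemma bounded_opD p x y : p (x + y) = p x + p y.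
Proof. exact: raddfD. Qed.

Lemma bounded_opB p x y : p (x - y) = p x - p y.
Proof. exact: raddfB. Qed.

End BoundedOpArithmetic.

(** Separates three errors made when everything is frozen at a later time t: the variation of Dl,
    that of the derivative of the flow transported by Q, and the perturbation q of the argument. *)
Lemma composite_difference {R : realType} {X : normedModType R}
    (Dw Dt : bounded_op X R) (Pw Pt Q : bounded_op X X) (b q : X) :
  Dw (Pw b) - Dt (Pt (Q (b + q))) =
  (Dw - Dt) (Pw b) + (Dt (Pw b - Pt (Q b)) - Dt (Pt (Q q))).
Proof.
rewrite bounded_op_subE (bounded_opD Q) (bounded_opD Pt) (bounded_opD Dt).
by rewrite (bounded_opB Dt); ring.
Qed.

Lemma expansion_difference {R : realType} {X : normedModType R}
    (D : bounded_op X R) (r1 r2 : R) (c1 c2 p : X) :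
  r1 - r2 - D p = - (r2 - r1 - D (c2 - c1)) + D (c1 - c2 - p).
Proof. by rewrite !(bounded_opB D); ring. Qed.

(** * Uniform continuity near compact sets *)

Section CompactContinuity.
Context {R : realType} {V W : normedModType R}.

Lemma continuous_compact_bound (f : V -> W) (K : set V) :
  continuous f -> compact K -> exists2 B : R, 0 <= B & forall x, K x -> `|f x| <= B.
Proof.
move=> cf cK.
have : bounded_set (f @` K).
  apply: compact_bounded; apply: continuous_compact => //.
  exact: continuous_subspaceT.
move=> /pinfty_ex_gt0[B B0 hB]; exists B; first exact: ltW.
by move=> x Kx; apply: hB; exists x.
Qed.

(** Only [x] is confined to the compact set: a segment between two points of a curve leaves the
    curve, and Dl has to be controlled along it. *)
Lemma compact_uniform_continuity (f : V -> W) (K : set V) (e : R) :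
  continuous f -> compact K -> 0 < e ->
  exists2 d : R, 0 < d &
    forall x z, K x -> `|z - x| <= d -> `|f z - f x| <= e.
Proof.
move=> cf /compact_near_coveringP cK e0.
have := cK R (0^'+) (fun d x => forall z, `|z - x| <= d -> `|f z - f x| <= e)
  (at_right_proper_filter _).
have near_K x : K x -> \forall x' \near x & d \near 0^'+,
    forall z, `|z - x'| <= d -> `|f z - f x'| <= e.
  move=> Kx; have e2 : 0 < e / 2 by rewrite divr_gt0.
  have /cvgrPdist_le/(_ _ e2)/nbhs_ballP[r /= r0 hr] := cf x.
  have r2 : 0 < r / 2 by rewrite divr_gt0.
  exists (ball x (r / 2), [set d | d < r / 2]) => /=.
    by split; [exact: nbhsx_ballx|exact: nbhs_right_lt].
  move=> [x' d] /= [xx' dr] z zx'.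
  have fx' : `|f x - f x'| <= e / 2.
    by apply: hr; apply: le_ball xx'; lra.
  have fz : `|f x - f z| <= e / 2.
    apply: hr; rewrite -ball_normE /= -(subrKA x').
    apply: le_lt_trans (ler_normD _ _) _; rewrite (splitr r) ltrD//.
      by move: xx'; rewrite -ball_normE.
    by rewrite distrC (le_lt_trans zx').
  rewrite -(subrKA (f x)) (splitr e); apply: le_trans (ler_normD _ _) _.
  by rewrite lerD// distrC.
move=> /(_ near_K) => h.
near (0 : R)^'+ => d.
exists d; first by near: d; exact: nbhs_right_gt.
by move=> x z Kx; move: x Kx z; near: d.
Unshelve. all: by end_near. Qed.

End CompactContinuity.

(** * From local approximation to an integral formula *)

Section LocalApproximation.
Context {R : realType}.
Notation leb := (@lebesgue_measure R).

Lemma ae_integral_glue (s r t : R) (h g1 g2 : R -> R) (a b e : R) :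
  s <= r -> r <= t ->
  ae_integral leb `[s, r] g1 a -> ae_integral leb `[r, t] g2 b ->
  {ae leb, forall w, w \in `[s, r] -> `|h w - g1 w| <= e} ->
  {ae leb, forall w, w \in `[r, t] -> `|h w - g2 w| <= e} ->
  exists g, ae_integral leb `[s, t] g (a + b) /\
    {ae leb, forall w, w \in `[s, t] -> `|h w - g w| <= e}.
Proof.
move=> sr rt i1 i2 h1 h2.
exists (fun w => if w <= r then g1 w else g2 w); split; last first.
  move: h1 h2; apply: (@filterS2 _ _ (ae_filter_ringOfSetsType leb)) => w h1 h2.
  rewrite in_itv/= => /andP[sw wt]; case: (leP w r) => wr.
    by apply: h1; rewrite in_itv/= sw.
  by apply: h2; rewrite in_itv/= wt ltW.
apply: (ae_integral_itv_cat sr rt).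
  apply: ae_integral_eq i1; apply: aeW => w /=; rewrite in_itv/= => /andP[_ ->].
  by [].
apply: ae_integral_eq i2; exists [set r]; split => //.
  exact: lebesgue_measure_set1.
move=> w /= /not_implyP[]; rewrite in_itv/= => /andP[rw _].
by case: (leP w r) => // wr _; apply/eqP; rewrite eq_le wr.
Qed.

(** A fundamental theorem of calculus without derivatives: increments are matched up to an error
    proportional to the length, uniformly in the position, and such errors add up to at most e T. *)
Lemma ae_integral_local_approximation (T : R) (h phi : R -> R) : 0 < T ->
  (forall e, 0 < e -> exists2 d, 0 < d &
     forall s t, 0 <= s -> s <= t -> t <= T -> t - s <= d ->
     exists g a, [/\ ae_integral leb `[s, t] g a,
       {ae leb, forall w, w \in `[s, t] -> `|h w - g w| <= e} &
       `|phi t - phi s - a| <= e * (t - s)]) ->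
  ae_integral leb `[0, T] h (phi T - phi 0).
Proof.
move=> T0 loc; apply: ae_integral_limit => //.
  exact: lebesgue_itv_lty.
(* This choice meets both demands, e' <= e for the integrand and e' T <= e for the summed
   increments. *)
move=> e e0; pose e' := e / (T + 1).
have T1 : 0 < T + 1 by rewrite ltr_wpDr// ltW.
have e'0 : 0 < e' by rewrite divr_gt0.
have e'e : e' <= e.
  by rewrite ler_pdivrMr// ler_peMr//; [exact: ltW|rewrite lerDr ltW].
have e'T : e' * T <= e.
  by rewrite /e' mulrAC ler_pdivrMr// ler_wpM2l ?ltW// ltrDl.
have [d d0 hd] := loc e' e'0.
pose n := (Num.truncn (T / d)).+1.
have n0 : 0 < n%:R :> R by rewrite ltr0n.
pose st := T / n%:R.
have st0 : 0 < st by rewrite divr_gt0.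
have std : st <= d.
  rewrite ler_pdivrMr// -ler_pdivrMl// mulrC.
  by have /andP[_ /ltW] := truncn_itv (divr_ge0 (ltW T0) (ltW d0)).
have stn : n%:R * st = T by rewrite /st mulrC divfK// gt_eqF.
have step k : (k <= n)%N -> exists g a, [/\ ae_integral leb `[0, k%:R * st] g a,
    {ae leb, forall w, w \in `[0, k%:R * st] -> `|h w - g w| <= e'} &
    `|phi (k%:R * st) - phi 0 - a| <= e' * (k%:R * st)].
  elim: k => [_|k ih kn].
    rewrite mul0r; have := hd 0 0 (lexx 0) (lexx 0) (ltW T0).
    by rewrite subrr => /(_ (ltW d0)).
  have [g1 [a1 [i1 h1 p1]]] := ih (ltnW kn).
  have s0 : 0 <= k%:R * st by rewrite mulr_ge0// ltW.
  have kE : k.+1%:R * st = k%:R * st + st by rewrite -natr1 mulrDl mul1r.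
  have ss : k%:R * st <= k.+1%:R * st by rewrite kE lerDl ltW.
  have sT : k.+1%:R * st <= T by rewrite -[leRHS]stn ler_wpM2r ?ler_nat// ltW.
  have [|g2 [a2 [i2 h2 p2]]] := hd _ _ s0 ss sT; first by rewrite kE addrAC subrr add0r.
  have [g [ig hg]] := ae_integral_glue s0 ss i1 i2 h1 h2.
  exists g, (a1 + a2); split => //.
  have -> : e' * (k.+1%:R * st) = e' * (k.+1%:R * st - k%:R * st) + e' * (k%:R * st).
    by ring.
  apply: le_trans (lerD p2 p1); apply: le_trans (ler_normD _ _).
  by rewrite le_eqVlt; apply/orP; left; apply/eqP; congr `|_|; ring.
have [g [a [ig hg pg]]] := step n (leqnn n).
rewrite stn in ig hg pg; exists g, a; split => //; last exact: le_trans pg e'T.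
move: hg; apply: (@filterS _ _ (ae_filter_ringOfSetsType leb)) => w hw wT.
by apply: le_trans e'e; exact: hw.
Qed.

End LocalApproximation.

(** * The flow of the mild equation *)

Section MildFlow.
Context {R : realType} {X : completeNormedModType R}.
Notation leb := (@lebesgue_measure R).
Variables (S : R -> bounded_op X X) (T MS : R).
Hypothesis S_semigroup : C0_semigroup S.
Hypothesis MS1 : 1 <= MS.
Hypothesis S_bound : forall t x, 0 <= t <= T -> `|S t x| <= MS * `|x|.
Variables (F : R -> X -> X) (L N : R).
Hypothesis L_gt0 : 0 < L.
Hypothesis N_ge0 : 0 <= N.
Hypothesis F_lip : {ae leb, forall t, t \in `[0, T] ->
  forall x y, `|F t x - F t y| <= L * `|x - y|}.
Hypothesis F_second_difference : {ae leb, forall t, t \in `[0, T] ->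
  forall x a b, `|F t (a + (b + x)) - F t (b + x) - (F t (a + x) - F t x)| <=
                N * `|b| * `|a|}.
Variable Phi : R -> R -> X -> X.
Hypothesis Phi_mild : forall s x, 0 <= s <= T ->
  mild S s T (fun t => F t (Phi s t x)) x (Phi s ^~ x).
Implicit Types (s r t : R) (x y z : X).

Definition gronwall_cst : R := 2 * MS * expR (2 * (MS * L) * T).
Local Notation C := gronwall_cst.

Let MS0 : 0 <= MS. Proof. exact: le_trans MS1. Qed.

Lemma gronwall_cst_ge0 : 0 <= C.
Proof. by rewrite /C !mulr_ge0// expR_ge0. Qed.

Lemma ae_subinterval s t (P : R -> Prop) : 0 <= s -> t <= T ->
  {ae leb, forall w, w \in `[0, T] -> P w} ->
  {ae leb, forall w, w \in `[s, t] -> P w}.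
Proof.
move=> s0 tT; apply: (@filterS _ _ (ae_filter_ringOfSetsType leb)) => x Px.
rewrite in_itv/= => /andP[sx xt]; apply: Px.
by rewrite in_itv/= (le_trans s0)// (le_trans xt).
Qed.

Lemma mild_flow_unique s t g z Z : 0 <= s -> s <= t -> t <= T ->
  mild S s t g z Z ->
  {ae leb, forall w, w \in `[s, t] -> g w = F w (Z w)} ->
  Z t = Phi s t z.
Proof.
move=> s0 st tT mZ gF; have sT : 0 <= s <= T by rewrite s0 (le_trans st).
have mP := mild_sub tT (Phi_mild z sT).
have mD := mildB mZ mP.
have := mild_gronwall MS1 S_bound s0 tT L_gt0 (lexx 0) mD.
rewrite subrr normr0 mul0r add0r mulr0 => h.
apply/eqP; rewrite -subr_eq0 -normr_le0; apply: h; last by rewrite st lexx.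
have := ae_subinterval s0 tT F_lip.
move: gF; apply: (@filterS2 _ _ (ae_filter_ringOfSetsType leb)) => x gF Fl xst.
by rewrite addr0 gF// Fl.
Qed.

Lemma flow_initial s x : 0 <= s <= T -> Phi s s x = x.
Proof.
by move=> /[dup] /andP[_ sT] s0T; exact: (mild_initial S_semigroup sT (Phi_mild x s0T)).
Qed.

Lemma flow_comp s r t x : 0 <= s -> s <= r -> r <= t -> t <= T ->
  Phi s t x = Phi r t (Phi s r x).
Proof.
move=> s0 sr rt tT; have sT : 0 <= s <= T by rewrite s0 (le_trans sr)// (le_trans rt).
have rT := le_trans rt tT.
have m := mild_restart S_semigroup sr rT (Phi_mild x sT).
apply: (mild_flow_unique _ rt tT (mild_sub tT m)); first exact: le_trans sr.
exact: aeW.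
Qed.

Lemma flow_lipschitz s t x y : 0 <= s -> s <= t -> t <= T ->
  `|Phi s t x - Phi s t y| <= C * `|x - y|.
Proof.
move=> s0 st tT; have sT : 0 <= s <= T by rewrite s0 (le_trans st).
have m := mildB (Phi_mild x sT) (Phi_mild y sT).
have := mild_gronwall MS1 S_bound s0 (lexx T) L_gt0 (lexx 0) m.
rewrite mul0r addr0; apply; last by rewrite st.
have := ae_subinterval s0 (lexx T) F_lip.
apply: (@filterS _ _ (ae_filter_ringOfSetsType leb)) => w Fl ws.
by rewrite addr0 Fl.
Qed.

(** To first order in t - s the flow moves differences by the semigroup alone; this is the source of
    P(s) = P(t) S_(t - s) + O(t - s). *)
Lemma flow_semigroup_difference s t x y : 0 <= s -> s <= t -> t <= T ->
  `|Phi s t x - Phi s t y - S (t - s) (x - y)| <=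
    MS * (L * (C * `|x - y|)) * (t - s).
Proof.
move=> s0 st tT; have sT : 0 <= s <= T by rewrite s0 (le_trans st).
have m := mildB (Phi_mild x sT) (Phi_mild y sT).
apply: (mild_bound MS1 S_bound s0 (lexx T) _ m); last by rewrite st.
  by rewrite !mulr_ge0 ?gronwall_cst_ge0// ltW.
have := ae_subinterval s0 (lexx T) F_lip.
apply: (@filterS _ _ (ae_filter_ringOfSetsType leb)) => w Fl ws.
apply: le_trans (Fl ws _ _) _; rewrite ler_wpM2l//; first exact: ltW.
by move: ws; rewrite in_itv/= => /andP[sw wT]; exact: flow_lipschitz.
Qed.

(** The source term is N (C |b|) (C |a|), it acts for a time at most T, and the outer C is the
    Gronwall factor. *)
Definition flow_second_cst : R := C * (N * C * C * T).

Lemma flow_second_cst_ge0 : 0 <= T -> 0 <= flow_second_cst.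
Proof. by move=> T0; rewrite /flow_second_cst !mulr_ge0 ?gronwall_cst_ge0. Qed.

Lemma flow_second_difference s t x a b : 0 <= s -> s <= t -> t <= T ->
  `|Phi s t (a + (b + x)) - Phi s t (b + x) - (Phi s t (a + x) - Phi s t x)| <=
    flow_second_cst * `|b| * `|a|.
Proof.
move=> s0 st tT; have sT : 0 <= s <= T by rewrite s0 (le_trans st).
have C0 := gronwall_cst_ge0.
have m := mildB (mildB (Phi_mild (a + (b + x)) sT) (Phi_mild (b + x) sT))
                (mildB (Phi_mild (a + x) sT) (Phi_mild x sT)).
have k0 : 0 <= N * (C * `|b|) * (C * `|a|) by rewrite !mulr_ge0.
have := mild_gronwall MS1 S_bound s0 (lexx T) L_gt0 k0 m.
(* The initial value of the second difference is 0, so only the source term contributes. *)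
rewrite !addrK subrr normr0 add0r => h.
apply: le_trans (h _ t _) _; last 2 first.
- by rewrite st.
- rewrite -/C /flow_second_cst.
  have : N * (C * `|b|) * (C * `|a|) * (T - s) <= N * (C * `|b|) * (C * `|a|) * T.
    by rewrite ler_wpM2l// lerBlDr lerDl.
  move=> /(ler_wpM2l C0) h'; apply: le_trans h' _.
  by rewrite le_eqVlt; apply/orP; left; apply/eqP; ring.
have := ae_subinterval s0 (lexx T) F_second_difference.
have := ae_subinterval s0 (lexx T) F_lip.
apply: (@filterS2 _ _ (ae_filter_ringOfSetsType leb)) => w Fl Fs ws.
have sw : s <= w /\ w <= T by move: ws; rewrite in_itv/= => /andP[].
have [{}sw wT] := sw.
set p := Phi s w x; set A := Phi s w (a + (b + x)).
set B := Phi s w (b + x); set D := Phi s w (a + x).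
(* The four states need not form a parallelogram. Replacing A by the fourth vertex D - p + B costs L
   times the norm of the quantity being estimated; what remains is a true second difference of F. *)
have h1 := Fs ws p (D - p) (B - p); rewrite !subrK in h1.
have h2 := Fl ws A (D - p + B).
have h3 : `|B - p| <= C * `|b|.
  by have := flow_lipschitz (b + x) x s0 sw wT; rewrite addrK.
have h4 : `|D - p| <= C * `|a|.
  by have := flow_lipschitz (a + x) x s0 sw wT; rewrite addrK.
have -> : F w A - F w B - (F w D - F w p) = F w A - F w (D - p + B) +
     (F w (D - p + B) - F w B - (F w D - F w p)).
  by rewrite [RHS]addrA subrKA.
apply: le_trans (ler_normD _ _) _; apply: lerD.
  by apply: le_trans h2 _; rewrite [D - p + B]addrC opprD addrA.
apply: le_trans h1 _; rewrite ler_pM ?mulr_ge0// ler_wpM2l//.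
Qed.

Lemma flow_differentiable s t x : 0 <= s -> s <= t -> t <= T ->
  [/\ differentiable (Phi s t) x,
      forall a, `|Phi s t (a + x) - Phi s t x - fderiv (Phi s t) x a| <=
                flow_second_cst * `|a| ^+ 2 &
      forall a, `|fderiv (Phi s t) x a| <= C * `|a|].
Proof.
move=> s0 st tT; apply: differentiable_of_second_difference.
  by move=> y z; exact: flow_lipschitz.
by move=> y a b; exact: flow_second_difference.
Qed.

(* Along a curve [y] driven by another field [g], [y t - Phi s t (y s)] measures
   by how much [y] leaves the flow between the times [s] and [t]. *)
Section Curve.
Variables (g y : R -> X) (x0 : X) (B : R).
Hypothesis B_ge0 : 0 <= B.
Hypothesis y_mild : mild S 0 T g x0 y.
Hypothesis gF : {ae leb, forall t, t \in `[0, T] -> `|g t - F t (y t)| <= B}.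

Definition defect s t : X := y t - Phi s t (y s).

Lemma defect_mild s : 0 <= s <= T ->
  mild S s T (fun t => g t - F t (Phi s t (y s))) 0 (defect s).
Proof.
move=> /[dup] s0T /andP[s0 sT]; rewrite -(subrr (y s)).
exact: mildB (mild_restart S_semigroup s0 sT y_mild) (Phi_mild _ s0T).
Qed.

Lemma defect_bound s t : 0 <= s -> s <= t -> t <= T ->
  `|defect s t| <= C * B * (t - s).
Proof.
move=> s0 st tT; have sT : 0 <= s <= T by rewrite s0 (le_trans st).
have := mild_gronwall MS1 S_bound s0 tT L_gt0 B_ge0 (mild_sub tT (defect_mild sT)).
rewrite normr0 add0r => h.
rewrite -mulrA; apply: h; last by rewrite st lexx.
have := ae_subinterval s0 tT F_lip.
have := ae_subinterval s0 tT gF.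
apply: (@filterS2 _ _ (ae_filter_ringOfSetsType leb)) => w gw Fl ws.
rewrite -(subrKA (F w (y w))); apply: le_trans (ler_normD _ _) _.
by rewrite addrC; apply: lerD; [exact: Fl|exact: gw].
Qed.

Definition endpoint t : X := Phi t T (y t).
Definition endpoint_derivative t : bounded_op X X := fderiv (Phi t T) (y t).

(** By the flow property [endpoint s] is the flow from t to T applied to [y t - defect s t], so this
    is the quadratic remainder at [y t]. *)
Lemma endpoint_expansion s t : 0 <= s -> s <= t -> t <= T ->
  `|endpoint t - endpoint s - endpoint_derivative t (defect s t)| <=
    flow_second_cst * (C * B * (t - s)) ^+ 2.
Proof.
move=> s0 st tT; have t0 : 0 <= t by exact: le_trans st.
have [_ h _] := flow_differentiable (y t) t0 tT (lexx T).
have := h (- defect s t); rewrite raddfN normrN opprK.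
have -> : - defect s t + y t = Phi s t (y s) by rewrite opprB subrK.
rewrite -(flow_comp _ s0 st tT (lexx T)) -normrN opprD opprB => h1.
apply: le_trans h1 _; rewrite ler_wpM2l//.
  by rewrite /flow_second_cst !mulr_ge0 ?gronwall_cst_ge0// (le_trans t0).
rewrite ler_sqr ?nnegrE// ?mulr_ge0 ?gronwall_cst_ge0 ?subr_ge0//.
exact: defect_bound.
Qed.

Lemma endpoint_lipschitz s t : 0 <= s -> s <= t -> t <= T ->
  `|endpoint t - endpoint s| <= C * (C * B * (t - s)).
Proof.
move=> s0 st tT; have t0 : 0 <= t by exact: le_trans st.
rewrite /endpoint (flow_comp (y s) s0 st tT (lexx T)).
apply: le_trans (flow_lipschitz _ _ t0 tT (lexx T)) _.
by rewrite ler_wpM2l ?gronwall_cst_ge0//; exact: defect_bound.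
Qed.

(** The first term pays for moving the base point by the defect, through second differences; the
    second for replacing the flow from s to t by the semigroup. *)
Definition derivative_cst : R := 
  flow_second_cst * (C * B) * C + C * (MS * (L * C)).

(** Both derivatives are compared through increments in direction h w, using that the flow from s to
    T factors through time t. The remainders are of order h^2 and disappear after division by h. *)
Lemma endpoint_derivative_bound s t w : 0 <= s -> s <= t -> t <= T ->
  `|endpoint_derivative s w - endpoint_derivative t (S (t - s) w)| <=
    derivative_cst * (t - s) * `|w|.
Proof.
move=> s0 st tT; have t0 : 0 <= t by exact: le_trans st.
have sT := le_trans st tT; have C0 := gronwall_cst_ge0.
have K0 : 0 <= flow_second_cst.
  by rewrite /flow_second_cst !mulr_ge0// (le_trans t0).
set K := flow_second_cst in K0 *.
have [_ e1 _] := flow_differentiable (y s) s0 sT (lexx T).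
have [_ e2 e3] := flow_differentiable (y t) t0 tT (lexx T).
set y1 := Phi s t (y s).
have key h : 0 < h ->
    h * `|endpoint_derivative s w - endpoint_derivative t (S (t - s) w)| <=
    h * (derivative_cst * (t - s) * `|w|) +
    h * (h * ((K + K * C ^+ 2) * `|w| ^+ 2)).
  move=> h0; set dh := Phi s t (h *: w + y s) - y1.
  have dhC : `|dh| <= C * (h * `|w|).
    have := flow_lipschitz (h *: w + y s) (y s) s0 st tT.
    by rewrite addrK normrZ gtr0_norm.
  have a1 := e1 (h *: w).
  have a2 := flow_second_difference (y t) dh (y1 - y t) t0 tT (lexx T).
  rewrite subrK in a2.
  have a3 := e2 dh.
  have a4 := e3 (dh - S (t - s) (h *: w)).
  have a5 := flow_semigroup_difference (h *: w + y s) (y s) s0 st tT.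
  rewrite addrK -/dh -/y1 normrZ (gtr0_norm h0) in a5.
  have E : Phi s T (h *: w + y s) - Phi s T (y s) = Phi t T (dh + y1) - Phi t T y1.
    by rewrite !(flow_comp _ s0 st tT (lexx T)) subrK.
  rewrite E in a1.
  rewrite -[X in X * _](gtr0_norm h0) -normrZ scalerBr.
  rewrite -!linearZ/=.
  (* The four terms are: remainder at [y s], change of base point from [y1] to [y t], remainder at
     [y t], deviation of the flow from the semigroup. *)
  have -> : endpoint_derivative s (h *: w) - endpoint_derivative t (S (t - s) (h *: w)) =
    - (Phi t T (dh + y1) - Phi t T y1 - endpoint_derivative s (h *: w)) +
    ((Phi t T (dh + y1) - Phi t T y1 - (Phi t T (dh + y t) - Phi t T (y t))) +
    ((Phi t T (dh + y t) - Phi t T (y t) - endpoint_derivative t dh) +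
     endpoint_derivative t (dh - S (t - s) (h *: w)))).
    have -> : endpoint_derivative t (dh - S (t - s) (h *: w)) =
        endpoint_derivative t dh - endpoint_derivative t (S (t - s) (h *: w)).
      exact: bounded_opB.
    by rewrite !subrKA opprB subrKA.
  apply: le_trans (ler_normD _ _) _; rewrite normrN.
  apply: le_trans (lerD (lexx _) (ler_normD _ _)) _.
  apply: le_trans (lerD (lexx _) (lerD (lexx _) (ler_normD _ _))) _.
  rewrite normrZ (gtr0_norm h0) in a1.
  have b2 : flow_second_cst * `|y1 - y t| * `|dh| <=
      K * (C * B * (t - s)) * (C * (h * `|w|)).
    rewrite -/K; apply: ler_pM => //; first by rewrite mulr_ge0.
    rewrite ler_wpM2l// distrC; exact: defect_bound.
  have b3 : flow_second_cst * `|dh| ^+ 2 <= K * (C * (h * `|w|)) ^+ 2.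
    by rewrite -/K ler_wpM2l// ler_sqr ?nnegrE// !mulr_ge0// ltW.
  have b4 : C * `|dh - S (t - s) (h *: w)| <=
      C * (MS * (L * (C * (h * `|w|))) * (t - s)) by rewrite ler_wpM2l.
  apply: le_trans (lerD a1 (lerD (le_trans a2 b2) (lerD (le_trans a3 b3) (le_trans a4 b4)))) _.
  rewrite -/K /derivative_cst -/K.
  by rewrite le_eqVlt; apply/orP; left; apply/eqP; ring.
apply/ler_addgt0Pl => e e0.
set q := (K + K * C ^+ 2) * `|w| ^+ 2 in key.
have q0 : 0 <= q by rewrite /q mulr_ge0 ?exprn_ge0// addr_ge0// mulr_ge0// exprn_ge0.
have q1 : 0 < q + 1 by rewrite ltr_wpDl.
have h0 : 0 < e / (q + 1) by rewrite divr_gt0.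
have := key _ h0; rewrite -mulrDr ler_pM2l// => /le_trans; apply.
rewrite addrC lerD2r mulrAC ler_pdivrMr// ler_wpM2l ?ltW//.
by rewrite ltrDl.
Qed.

Lemma endpoint_curve_compact : compact (endpoint @` `[0, T]).
Proof.
apply: continuous_compact; last exact: segment_compact.
have K0 : 0 <= C * (C * B) by rewrite !mulr_ge0 ?gronwall_cst_ge0.
have lip s t : s \in `[0, T] -> t \in `[0, T] ->
    `|endpoint s - endpoint t| <= C * (C * B) * `|s - t|.
  rewrite !in_itv/= => /andP[s0 sT] /andP[t0 tT].
  have ord a b : 0 <= a -> a <= b -> b <= T ->
      `|endpoint b - endpoint a| <= C * (C * B) * `|b - a|.
    move=> a0 ab bT; rewrite ger0_norm ?subr_ge0// -mulrA.
    by apply: endpoint_lipschitz.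
  have [st|/ltW ts] := leP s t; last exact: ord.
  by rewrite (distrC (endpoint s)) (distrC s); exact: ord.
apply/subspace_continuousP => s sT; apply/cvgrPdist_le => e e0.
rewrite near_withinE; apply/nbhs_ballP.
have K1 : 0 < C * (C * B) + 1 by rewrite ltr_wpDl.
exists (e / (C * (C * B) + 1)) => /=; first by rewrite divr_gt0.
move=> t; rewrite -ball_normE /= => st tT; apply: le_trans (lip _ _ sT tT) _.
apply: le_trans (ler_wpM2l K0 (ltW st)) _.
rewrite mulrCA ler_piMr//; first exact: ltW.
by rewrite ler_pdivrMr// mul1r lerDl.
Qed.

Local Opaque gronwall_cst flow_second_cst derivative_cst.

Lemma endpoint_functional_integral (l : X -> R) : C1 l -> 0 < T ->
  ae_integral leb `[0, T]
    (fun t => fderiv l (endpoint t) (endpoint_derivative t (g t - F t (y t))))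
    (l (endpoint T) - l (endpoint 0)).
Proof.
move=> [dl cl] T0; have C0 := gronwall_cst_ge0.
have MS0' := MS0; have L0 := ltW L_gt0.
have K0 : 0 <= flow_second_cst by apply: flow_second_cst_ge0; exact: ltW.
have CB0 : 0 <= C * B by exact: mulr_ge0.
have D0 : 0 <= derivative_cst.
  exact: (addr_ge0 (mulr_ge0 (mulr_ge0 K0 CB0) C0)
                   (mulr_ge0 C0 (mulr_ge0 MS0' (mulr_ge0 L0 C0)))).
have [Bl Bl0 hBl] := continuous_compact_bound cl endpoint_curve_compact.
apply: (ae_integral_local_approximation (phi := l \o endpoint)) => // e e0.
(* The oscillation e1 of Dl enters the integrand with factor C B and the increment with factor C (C
   B); either share stays below e / 2. *)
pose e1 := e / (2 * (C * B + C * (C * B) + 1)).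
have den1 : 0 < C * B + C * (C * B) + 1 by rewrite ltr_wpDl// addr_ge0// !mulr_ge0.
have e10 : 0 < e1 by rewrite divr_gt0// mulr_gt0.
have [d1 d10 hd1] := compact_uniform_continuity cl endpoint_curve_compact e10.
(* Collects all coefficients of t - s from both estimates; the final 1 makes it positive. *)
pose Q := Bl * derivative_cst * B + Bl * (C * (MS * (L * (C * B)))) +
  Bl * (flow_second_cst * (C * B) ^+ 2) + 1.
have q1 : 0 <= Bl * derivative_cst * B by exact: mulr_ge0 (mulr_ge0 Bl0 D0) B_ge0.
have q2 : 0 <= Bl * (C * (MS * (L * (C * B)))).
  exact: mulr_ge0 Bl0 (mulr_ge0 C0 (mulr_ge0 MS0' (mulr_ge0 L0 CB0))).
have q3 : 0 <= Bl * (flow_second_cst * (C * B) ^+ 2).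
  exact: mulr_ge0 Bl0 (mulr_ge0 K0 (exprn_ge0 _ CB0)).
have Q0 : 0 < Q.
  by rewrite /Q; lra.
(* The first bound gives Q (t - s) <= e / 2, the second keeps the endpoint curve within d1 of its
   value at t. *)
pose d := Num.min (e / (2 * Q)) (d1 / (C * (C * B) + 1)).
have CCB : 0 < C * (C * B) + 1 by rewrite ltr_wpDl// !mulr_ge0.
have d0 : 0 < d by rewrite lt_min !divr_gt0// mulr_gt0.
exists d => // s t s0 st tT std.
have s0T : 0 <= s <= T by rewrite s0 (le_trans st).
have t0 := le_trans s0 st.
have dist w : s <= w -> w <= t -> `|endpoint t - endpoint w| <= d1.
  move=> sw wt; apply: le_trans (endpoint_lipschitz (le_trans s0 sw) wt tT) _.
  have wd : t - w <= d1 / (C * (C * B) + 1).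
    apply: le_trans (_ : t - s <= _); first by rewrite lerB.
    by apply: le_trans std _; rewrite ge_min lexx orbT.
  rewrite ler_pdivlMr// in wd; rewrite mulrA; apply: le_trans wd.
  rewrite [leRHS]mulrC ler_wpM2r ?subr_ge0//.
  by rewrite lerDl.
have in_curve w : 0 <= w -> w <= T -> (endpoint @` `[0, T]) (endpoint w).
  by move=> w0 wT; exists w => //=; rewrite in_itv/= w0.
have Dl_t : `|fderiv l (endpoint t)| <= Bl by apply: hBl; exact: in_curve.
have opl z w : `|fderiv l z w| <= `|fderiv l z| * `|w| by exact: opnorm_bound.
have tdQ : Q * (t - s) <= e / 2.
  have : t - s <= e / (2 * Q) by apply: le_trans std _; rewrite ge_min lexx.
  by move=> /(ler_wpM2l (ltW Q0)); congr (_ <= _); field; rewrite gt_eqF.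
have e1E : e1 * (C * B + C * (C * B) + 1) = e / 2.
  by rewrite /e1; field; rewrite gt_eqF.
have ts0 : 0 <= t - s by rewrite subr_ge0.
(* The outer maps are frozen at the right end t. The integral is then exact, because S (t - w) is
   the kernel in the mild equation of the defect at time t. *)
exists (fun w => fderiv l (endpoint t) (endpoint_derivative t
    (S (t - w) (g w - F w (Phi s w (y s)))))),
  (fderiv l (endpoint t) (endpoint_derivative t (defect s t))); split.
- have [_ /(_ t)] := defect_mild s0T.
  rewrite st tT raddf0 subr0 => /(_ isT) h.
  exact: (weak_integral_op (endpoint_derivative t) h).
- have := ae_subinterval s0 tT F_lip; have := ae_subinterval s0 tT gF.
  apply: (@filterS2 _ _ (ae_filter_ringOfSetsType leb)) => w gw Fl ws.
  have bw := gw ws; have {}Fl := Fl ws.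
  move: ws; rewrite in_itv/= => /andP[sw wt].
  have w0 := le_trans s0 sw; have wT := le_trans wt tT.
  set b := g w - F w (y w) in bw *.
  (* The defect is driven by g minus F along the flow, not along y; q is the discrepancy, of the
     order of the defect itself. *)
  set q := F w (y w) - F w (Phi s w (y s)).
  have qle : `|q| <= L * (C * B * (t - s)).
    apply: le_trans (Fl _ _) _; rewrite ler_wpM2l//.
    apply: le_trans (defect_bound s0 sw wT) _.
    by rewrite ler_wpM2l ?mulr_ge0// lerB.
  have -> : g w - F w (Phi s w (y s)) = b + q by rewrite /b /q subrKA.
  have [_ _ Pw] := flow_differentiable (y w) w0 wT (lexx T).
  have [_ _ Pt] := flow_differentiable (y t) t0 tT (lexx T).
  have Dw : `|fderiv l (endpoint w) - fderiv l (endpoint t)| <= e1.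
    apply: hd1; first exact: in_curve.
    by rewrite distrC; exact: dist.
  have -> : fderiv l (endpoint w) (endpoint_derivative w b) -
     fderiv l (endpoint t) (endpoint_derivative t (S (t - w) (b + q))) =
     (fderiv l (endpoint w) - fderiv l (endpoint t)) (endpoint_derivative w b) +
     (fderiv l (endpoint t) (endpoint_derivative w b -
        endpoint_derivative t (S (t - w) b)) -
      fderiv l (endpoint t) (endpoint_derivative t (S (t - w) q))).
    exact: composite_difference.
  apply: le_trans (ler_normD _ _) _.
  apply: le_trans (lerD (lexx _) (ler_normB _ _)) _.
  have t1 : `|(fderiv l (endpoint w) - fderiv l (endpoint t)) (endpoint_derivative w b)|
      <= e1 * (C * B).
    apply: le_trans (opnorm_bound _ _) _; apply: ler_pM => //; first exact: opnorm_ge0.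
    by apply: le_trans (Pw _) _; rewrite ler_wpM2l.
  have t2 : `|fderiv l (endpoint t) (endpoint_derivative w b -
        endpoint_derivative t (S (t - w) b))| <= Bl * (derivative_cst * (t - s) * B).
    apply: le_trans (opl _ _) _; apply: ler_pM => //.
    apply: le_trans (endpoint_derivative_bound b w0 wt tT) _.
    apply: ler_pM => //; first by rewrite mulr_ge0// subr_ge0.
    by rewrite ler_wpM2l// lerB.
  have t3 : `|fderiv l (endpoint t) (endpoint_derivative t (S (t - w) q))| <=
      Bl * (C * (MS * (L * (C * B * (t - s))))).
    apply: le_trans (opl _ _) _; apply: ler_pM => //.
    apply: le_trans (Pt _) _; rewrite ler_wpM2l//.
    apply: le_trans (S_bound _ _) _; last by rewrite ler_wpM2l.
    by rewrite subr_ge0 wt/= lerBlDr (le_trans tT)// lerDl.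
  apply: le_trans (lerD t1 (lerD t2 t3)) _.
  have p1 : 0 <= e1 * (C * (C * B) + 1) by rewrite mulr_ge0 ?ltW.
  have p2 : 0 <= Bl * (flow_second_cst * (C * B) ^+ 2) * (t - s).
    exact: mulr_ge0.
  move: tdQ e1E; rewrite /Q; lra.
set c := endpoint.
(* The expansion of l is based at c(t), since the increment of c is expanded with the derivative at
   time t. *)
have h1 : `|l (c s) - l (c t) - fderiv l (c t) (c s - c t)| <= e1 * (C * (C * B * (t - s))).
  apply: le_trans (strict_derivative (e := e1) dl _) _.
    move=> z zc; apply: hd1; first exact: in_curve.
    by apply: le_trans zc _; rewrite distrC; exact: dist.
  have e1ge := ltW e10.
  by rewrite ler_wpM2l// distrC; exact: endpoint_lipschitz.
have h2 : `|fderiv l (c t) (c t - c s - endpoint_derivative t (defect s t))| <=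
    Bl * (flow_second_cst * (C * B * (t - s)) ^+ 2).
  by apply: le_trans (opl _ _) _; apply: ler_pM => //; exact: endpoint_expansion.
have -> : (l \o c) t - (l \o c) s - fderiv l (c t) (endpoint_derivative t (defect s t)) =
   - (l (c s) - l (c t) - fderiv l (c t) (c s - c t)) +
   fderiv l (c t) (c t - c s - endpoint_derivative t (defect s t)).
  exact: expansion_difference.
apply: le_trans (ler_normD _ _) _; rewrite normrN.
apply: le_trans (lerD h1 h2) _.
have -> : e1 * (C * (C * B * (t - s))) + Bl * (flow_second_cst * (C * B * (t - s)) ^+ 2) =
   (e1 * (C * (C * B)) + Bl * (flow_second_cst * (C * B) ^+ 2) * (t - s)) * (t - s) by ring.
rewrite ler_wpM2r//.
have e1ge := ltW e10.
have p1 : 0 <= e1 * (C * B + 1) by apply: mulr_ge0 => //; lra.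
have p2 : 0 <= (Bl * derivative_cst * B + Bl * (C * (MS * (L * (C * B)))) + 1) * (t - s).
  by apply: mulr_ge0 => //; lra.
move: tdQ e1E; rewrite /Q; lra.
Qed.

End Curve.
End MildFlow.

(** * Control-affine dynamics *)

Section ControlledFlow.
Context {R : realType} {X : completeNormedModType R} {m : nat}.
Notation leb := (@lebesgue_measure R).
Notation Rm := 'cV[R]_m.
Variables (T : R) (f : R -> X -> X) (G : R -> X -> bounded_op Rm X).

Lemma dynamics_lipschitz (v : R -> Rm) (r : R) : assumption_A T f G ->
  {ae leb, forall t, t \in `[0, T] -> `|v t| <= r} ->
  exists2 L : R, 0 < L & {ae leb, forall t, t \in `[0, T] -> forall x y,
    `|dynamics f G t x (v t) - dynamics f G t y (v t)| <= L * `|x - y|}.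
Proof.
move=> [_ [Mf [MG [Mf0 MG0 hA]]]] vr.
(* The summand 1 provides the strict positivity required by Gronwall's inequality. *)
exists (Mf + MG * `|r| + 1); first by rewrite ltr_wpDl// addr_ge0// mulr_ge0.
move: hA vr; apply: (@filterS2 _ _ (ae_filter_ringOfSetsType leb)) => t hA vr tT x y.
have [fL GL _ _] := hA tT; have {}vr := le_trans (vr tT) (ler_norm r).
have -> : dynamics f G t x (v t) - dynamics f G t y (v t) =
    (f t x - f t y) + (G t x - G t y) (v t).
  by rewrite /dynamics bounded_op_subE opprD addrACA.
apply: le_trans (ler_normD _ _) _.
rewrite mulrDl mul1r; apply: le_trans (_ : (Mf + MG * `|r|) * `|x - y| <= _); last first.
  by rewrite lerDl.
rewrite mulrDl lerD// mulrAC; apply: le_trans (opnorm_bound _ _) _.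
by apply: ler_pM => //; [exact: opnorm_ge0|exact: GL].
Qed.

Lemma dynamics_second_difference (v : R -> Rm) (r : R) : assumption_Aplus T f G ->
  {ae leb, forall t, t \in `[0, T] -> `|v t| <= r} ->
  exists2 N : R, 0 <= N & {ae leb, forall t, t \in `[0, T] -> forall x a b,
    `|dynamics f G t (a + (b + x)) (v t) - dynamics f G t (b + x) (v t) -
      (dynamics f G t (a + x) (v t) - dynamics f G t x (v t))| <= N * `|b| * `|a|}.
Proof.
move=> [hC1 _ [M M0 hM]] vr.
exists (M + M * `|r|); first by rewrite addr_ge0// mulr_ge0.
move: hC1 hM vr; apply: (@filterS3 _ _ (ae_filter_ringOfSetsType leb)) => t hC1 hM vr tT x a b.
have [[df _] [dG _]] := hC1 tT; have [_ _ fM GM] := hM tT.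
have {}vr := le_trans (vr tT) (ler_norm r).
have f2 := second_difference df fM x a b.
have G2 := second_difference dG GM x a b.
pose q := G t (a + (b + x)) - G t (b + x) - (G t (a + x) - G t x).
have zz (p1 q1 p2 q2 : X) : p1 + q1 - (p2 + q2) = (p1 - p2) + (q1 - q2).
  by rewrite opprD addrACA.
have -> : dynamics f G t (a + (b + x)) (v t) - dynamics f G t (b + x) (v t) -
      (dynamics f G t (a + x) (v t) - dynamics f G t x (v t)) =
    (f t (a + (b + x)) - f t (b + x) - (f t (a + x) - f t x)) + q (v t).
  by rewrite /dynamics (zz (f t (a + (b + x)))) (zz (f t (a + x))) zz /q !bounded_op_subE.
apply: le_trans (ler_normD _ _) _; rewrite !mulrDl lerD//.
have -> : M * `|r| * `|b| * `|a| = M * `|b| * `|a| * `|r| by ring.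
apply: le_trans (opnorm_bound _ _) _.
by apply: ler_pM => //; exact: opnorm_ge0.
Qed.

(** Extends the mild equation to s = T, where the flow is only given as the identity: the interval
    is a point and its integrals vanish. *)
Lemma is_flow_mild (S : R -> bounded_op X X) (U : set Rm)
    (Phi : (R -> Rm) -> R -> R -> X -> X) (v : R -> Rm) :
  C0_semigroup S -> is_flow S (dynamics f G) T U Phi -> admissible T U v ->
  forall s x, 0 <= s <= T ->
    mild S s T (fun t => dynamics f G t (Phi v s t x) (v t)) x (fun t => Phi v s t x).
Proof.
move=> [S0 _ _] Phi_flow va s x /andP[s0]; rewrite le_eqVlt => /predU1P[->|sT].
  have [_ PT] := Phi_flow _ va.
  split.
    apply/subspace_continuousP => t; rewrite /= in_itv/= => /andP[Tt tT].
    have -> : t = T by apply/eqP; rewrite eq_le Tt tT.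
    apply/cvgrPdist_le => e e0; rewrite near_withinE; near=> q.
    rewrite /= in_itv/= => /andP[Tq qT].
    have -> : q = T by apply/eqP; rewrite eq_le Tq qT.
    by rewrite subrr normr0 ltW.
  move=> r /andP[Tr rT]; have -> : r = T by apply/eqP; rewrite eq_le Tr rT.
  rewrite PT subrr S0 subrr => p; rewrite raddf0; exists (fun=> 0); split.
  - exact: integrable0.
  - exists [set T]; split => //; first exact: lebesgue_measure_set1.
    move=> w /= /not_implyP[]; rewrite in_itv/= => /andP[Tw wT] _.
    by apply/eqP; rewrite eq_le wT.
  - by rewrite set_itv1 Rintegral_set1.
have [/(_ s x) h _] := Phi_flow _ va.
have {h}[|cy hy] := h; first by rewrite s0.
split => // r rT; have [[w iw] yE] := hy r rT.
rewrite yE addrAC subrr add0r.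
(* The chosen value is a Bochner integral because one exists. *)
apply: bochner_weak_integral => //; rewrite /bochner_integral.
exact: (getPex (ex_intro _ w iw)).
Unshelve. all: by end_near. Qed.

End ControlledFlow.

Lemma sqnorm_continuous {R : realType} {m : nat} :
  continuous (sqnorm : 'cV[R]_m -> R).
Proof.
move=> v; apply: differentiable_continuous.
have -> : sqnorm = \sum_(i < m) (fun w : 'cV[R]_m => w i ord0 : R) ^+ 2.
  by apply/funext => w; rewrite fct_sumE.
apply: differentiable_sum => i; apply: differentiableX.
exact: differentiable_coord.
Qed.


(** * The increment formula for the cost *)

Theorem mainTheorem1 (R : realType) (X : completeNormedModType R) (m : nat)
    (T : R) (U : set 'cV[R]_m)
    (DA : set X) (A : X -> X) (S : R -> bounded_op X X)
    (f : R -> X -> X) (G : R -> X -> bounded_op 'cV[R]_m X)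
    (Phi : (R -> 'cV[R]_m) -> R -> R -> X -> X)
    (l : X -> R) (alpha : R) (x0 : X) (ubar u : R -> 'cV[R]_m)
    (T_gt0 : 0 < T)
    (U_compact : compact U) (U_convex : convex_set U)
    (A_generates_S : generates DA A S)
    (hA : assumption_A T f G) (hAplus : assumption_Aplus T f G)
    (Phi_flow : is_flow S (dynamics f G) T U Phi)
    (l_C1 : C1 l)
    (l_lipschitz : forall B : set X, bounded_set B -> [lipschitz l x | x in B])
    (alpha_ge0 : 0 <= alpha)
    (ubar_adm : admissible T U ubar) (u_adm : admissible T U u) :
  let x := fun t => Phi u 0 t x0 in
  let pbar := terminal_value T l Phi ubar in
  let Hbar := hamiltonian alpha G pbar in
  let J := cost T alpha l Phi x0 in
  let DH := fun t => Hbar t (x t) (u t) - Hbar t (x t) (ubar t) in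
  [/\ forall t, t \in `[0, T] -> forall y, differentiable (pbar t) y,
      bochner_integrable (@lebesgue_measure R) `[0, T] DH &
      J u - J ubar = \int[@lebesgue_measure R]_(t in `[0, T]) DH t].
Proof.
move=> x pbar Hbar J DH.
have T0 := ltW T_gt0.
have mT : measurable (`[0, T]%classic : set (g_sigma_algebraType R.-ocitv.-measurable)).
  exact: measurable_itv.
have [S_sg _ _] := A_generates_S.
have [MS MS1 S_bound] := C0_semigroup_bound S_sg T.
have [r r0 Ur] := @continuous_compact_bound R 'cV[R]_m 'cV[R]_m id U (fun y => cvg_id) U_compact.
have ctrl_bound v : admissible T U v ->
    {ae lebesgue_measure, forall t, t \in `[0, T] -> `|v t| <= r}.
  move=> [_]; apply: (@filterS _ _ (ae_filter_ringOfSetsType lebesgue_measure)) => t vU tT.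
  by apply: Ur; exact: vU.
have ubar_r := ctrl_bound _ ubar_adm; have u_r := ctrl_bound _ u_adm.
have [L L0 F_lip] := dynamics_lipschitz hA ubar_r.
have [N N0 F_sd] := dynamics_second_difference hAplus ubar_r.
have Phi_mild := is_flow_mild S_sg Phi_flow ubar_adm.
have x_mild : mild S 0 T (fun t => dynamics f G t (x t) (u t)) x0 x.
  by apply: (is_flow_mild S_sg Phi_flow u_adm); rewrite lexx.
have Psi_diff t y : t \in `[0, T] -> differentiable (Phi ubar t T) y.
  rewrite in_itv/= => /andP[t0 tT].
  by have [] := flow_differentiable MS1 S_bound L0 N0 F_lip F_sd Phi_mild y t0 tT (lexx T).
have [dl _] := l_C1.
have pbar_diff t y : t \in `[0, T] -> differentiable (pbar t) y.
  by move=> tT; apply: differentiable_comp; [exact: Psi_diff|exact: dl].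
have pbarE t y v : t \in `[0, T] ->
    fderiv (pbar t) y v = fderiv l (Phi ubar t T y) (fderiv (Phi ubar t T) y v).
  move=> tT; rewrite !fderivE//; [|exact: Psi_diff|exact: pbar_diff].
  by rewrite diff_comp//; exact: Psi_diff.
have [Bx Bx0 xB] : exists2 Bx, 0 <= Bx & forall t, t \in `[0, T] -> `|x t| <= Bx.
  have cx : compact (x @` `[0, T]).
    by apply: continuous_compact; [exact: x_mild.1|exact: segment_compact].
  have [Bx Bx0 xB] := @continuous_compact_bound R X X id _ (fun y => cvg_id) cx.
  by exists Bx => // t tT; apply: xB; exists t.
pose b t := dynamics f G t (x t) (u t) - dynamics f G t (x t) (ubar t).
have bE t : b t = G t (x t) (u t) - G t (x t) (ubar t).
  by rewrite /b /dynamics opprD addrACA subrr add0r.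
have [B B0 bB] : exists2 B, 0 <= B &
    {ae lebesgue_measure, forall t, t \in `[0, T] -> `|b t| <= B}.
  have [_ [Mf [MG [_ MG0 hG]]]] := hA.
  exists ((MG * Bx + MG) * (r + r)); first by rewrite mulr_ge0// addr_ge0// mulr_ge0.
  move: hG u_r ubar_r.
  apply: (@filterS3 _ _ (ae_filter_ringOfSetsType lebesgue_measure)) => t hG ut vt tT.
  have [_ GL _ G0] := hG tT.
  rewrite bE -raddfB; apply: le_trans (opnorm_bound _ _) _.
  apply: ler_pM => //; first exact: opnorm_ge0.
    rewrite -[G t (x t)](subrK (G t 0)); apply: le_trans (ler_opnormD _ _) _.
    apply: lerD; last exact: G0.
    apply: le_trans (GL _ _) _; rewrite subr0 ler_wpM2l//; exact: xB.
  by apply: le_trans (ler_normB _ _) _; apply: lerD; [exact: ut|exact: vt].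
(* The flow is that of ubar, and the curve is the trajectory of u with its own field as [g]; the
   deviation of the fields is [b]. *)
have main := endpoint_functional_integral S_sg MS1 S_bound L0 N0 F_lip F_sd
  Phi_mild B0 x_mild bB l_C1 T_gt0.
have sq_int v : admissible T U v -> exists a,
    ae_integral lebesgue_measure `[0, T] (fun t => sqnorm (v t)) a.
  move=> [vm vU].
  have [g mg vg] := strongly_measurable_comp mT sqnorm_continuous vm.
  have [B' _ hB'] := continuous_compact_bound (@sqnorm_continuous R m) U_compact.
  apply: (bounded_ae_integral mT (lebesgue_itv_lty _ _) mg vg (M := B')).
  move: vU; apply: (@filterS _ _ (ae_filter_ringOfSetsType lebesgue_measure)) => t vU tT.
  by apply: hB'; exact: vU.
have [a ia] := sq_int _ u_adm; have [abar iabar] := sq_int _ ubar_adm.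
have DHint : ae_integral lebesgue_measure `[0, T] DH (J u - J ubar).
  (* The last bracket is the increment of l between the ends of the endpoint curve. *)
  have JE : J u - J ubar = alpha / 2 * (a - abar) +
      (l (Phi ubar T T (x T)) - l (Phi ubar 0 T (x 0))).
    rewrite /J /cost (ae_integral_Rintegral mT ia) (ae_integral_Rintegral mT iabar).
    have TT : 0 <= T <= T by rewrite T0 lexx.
    have OT : 0 <= (0 : R) <= T by rewrite lexx.
    have -> : Phi ubar T T (x T) = x T.
      exact: (@flow_initial _ _ _ _ S_sg
        (fun t y => dynamics f G t y (ubar t)) _ Phi_mild _ _ TT).
    have -> : x 0 = x0.
      exact: (@flow_initial _ _ _ _ S_sg (fun t y => dynamics f G t y (u t)) _
        (is_flow_mild S_sg Phi_flow u_adm) _ _ OT).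
    rewrite /x; ring.
  rewrite JE.
  have h := ae_integralD mT (ae_integralZ (alpha / 2) mT (ae_integralB mT ia iabar)) main.
  apply: ae_integral_eq h; apply: aeW => t tT /=.
  (* The adjoint terms become the derivative of pbar applied to G u and G ubar, and the chain rule
     for pbar gives the integrand of [main]. *)
  rewrite /DH /Hbar /hamiltonian !adjointE !pbarE// -/(b t) bE.
  by rewrite /endpoint_derivative /endpoint !raddfB/=; ring.
split.
- by move=> t tT y; exact: pbar_diff.
- exact: (ae_integral_bochner_integrable mT (lebesgue_itv_lty _ _) DHint).
- by rewrite (ae_integral_Rintegral mT DHint).
Qed.
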